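(* Suppose Algorithm SPG (described in the context) is run without termination, with $\mathcal{O}(z^{(0)})<\theta$, $\tau_1\tau_3\ge1$, and $$\mu^{(0)}L^{(0)}\ge\max\left\{6\lambda_2N_1N_0+\frac{2}{\eta}\left(N_2L_{\widetilde{\mathcal{H}}}+\lambda_1N_1N\right),\ 8\lambda_2+L_{\nabla\widetilde{\mathcal{H}}}\right\}.$$ Then (a) $\lim_{k\to\infty}\mu^{(k)}=0$; (b) the sequences $\{\mathcal{O}(z^{(k)})\}$ and $\{\widetilde{\mathcal{O}}(z^{(k)},\mu^{(k)})\}$ are convergent, and $\lim_{k\to\infty}\widetilde{\mathcal{O}}(z^{(k)},\mu^{(k)})=\lim_{k\to\infty}\mathcal{O}(z^{(k)})$.
   Context: Let $N,N_0,N_1$ be positive integers, $X=(x_1,\ldots,x_N)\in\mathbb{R}^{N_0\times N}$ a given data matrix, and $\lambda_1,\lambda_2,\beta>0$ given parameters. For a real vector $y$, $(y)_+=\max\{y,0\}$ componentwise; $e$ denotes the all-ones vector of $\mathbb{R}^{N_1}$. For a matrix $Y$, $\|Y\|_F$ is the Frobenius norm and $\|Y\|_1$ the maximum absolute column sum. The variable is $z=(\mathrm{vec}(W)^\top,b^\top,\mathrm{vec}(V)^\top)^\top\in\mathbb{R}^{N_2}$, $N_2=N_0N_1+N_1+N_0+N_1N$, where $W\in\mathbb{R}^{N_1\times N_0}$, $b=(b_1^\top,b_2^\top)^\top$ with $b_1\in\mathbb{R}^{N_1}$, $b_2\in\mathbb{R}^{N_0}$, $V=(v_1,\ldots,v_N)\in\mathbb{R}^{N_1\times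 N}$, and vec is columnwise vectorization. Define $\mathcal{F}(z)=\frac1N\sum_{n=1}^N\|(W^\top v_n+b_2)_+-x_n\|_2^2$, $\mathcal{R}(z)=\lambda_1\sum_{n=1}^N e^\top v_n+\lambda_2\|W\|_F^2$, $\mathcal{P}(z)=\beta\sum_{n=1}^N e^\top(v_n-(Wx_n+b_1)_+)$, $\mathcal{O}=\mathcal{F}+\mathcal{R}+\mathcal{P}$. Let $\Omega_2=\{z: v_n\ge (Wx_n+b_1)_+,\ n=1,\ldots,N\}$. Fix $\theta>\frac1N\|X\|_F^2$ and set $\alpha=\max\left\{\frac{\theta}{\lambda_1}+\sqrt{\frac{N_1N_0\theta}{\lambda_2}}\|X\|_1,\ \frac{\theta\sqrt{N_1N_0\theta}}{\lambda_1\sqrt{\lambda_2}}+\sqrt{N\theta}+\|X\|_1\right\}$, $\eta=\max\{\sqrt{N_1N_0\theta/\lambda_2},\ \theta/\lambda_1\}$. Let $\Omega_3=\{z:\|b\|_\infty\le\alpha\}$, $\mathcal{Z}=\Omega_2\cap\Omega_3$, $\Omega_\theta=\{z\in\Omega_2:\mathcal{O}(z)\le\theta\}$. Smoothing: for $y\in\mathbb{R}^m$, $\mu>0$, $\widetilde\sigma(y,\mu)\in\mathbb{R}^m$ has components $\widetilde\sigma_i(y,\mu)=0$ if $y_i<0$, $y_i^2/(2\mu)$ if $0\le y_i\le\mu$, $y_i-\mu/2$ if $y_i>\mu$. Define $\widetilde{\mathcal{F}}(z,\mu)=\frac1N\sum_{n=1}^N\|(W^\top v_n+b_2)_+\|_2^2+\frac1N\|X\|_F^2-\frac2N\sum_{n=1}^Nx_n^\top\widetilde\sigma(W^\top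 v_n+b_2,\mu)$, $\widetilde{\mathcal{P}}(z,\mu)=\beta\sum_{n=1}^Ne^\top(v_n-\widetilde\sigma(Wx_n+b_1,\mu))$, $\widetilde{\mathcal{H}}=\widetilde{\mathcal{F}}+\widetilde{\mathcal{P}}$, $\widetilde{\mathcal{O}}(z,\mu)=\widetilde{\mathcal{H}}(z,\mu)+\mathcal{R}(z)$. Let $L_{\widetilde{\mathcal{H}}}$ be a Lipschitz constant of $(z,\mu)\mapsto\mu\widetilde{\mathcal{H}}(z,\mu)$ over $(\Omega_\theta\cap\mathcal{Z})\times(0,1)$, and $L_{\nabla\widetilde{\mathcal{H}}}$ a Lipschitz constant of $(z,\mu)\mapsto\mu\nabla_z\widetilde{\mathcal{H}}(z,\mu)$ over $\{z:\|z\|_\infty\le\max\{\alpha,2\eta\}\}\times(0,1)$. Algorithm SPG: choose $z^{(0)}\in\mathcal{Z}$, $0<\mu^{(0)}<1$, $0<\tau_1<1$, $\tau_2>0$, $\tau_3\ge1$, $L^{(0)}\ge1$. For $k=0,1,2,\ldots$: let $z^{(k+1)}$ be the unique minimizer over $z\in\mathcal{Z}$ of $\langle\nabla_z\widetilde{\mathcal{H}}(z^{(k)},\mu^{(k)}),z-z^{(k)}\rangle+\mathcal{R}(z)+\frac{L^{(k)}}2\|z-z^{(k)}\|_2^2$; then set $(\mu^{(k+1)},L^{(k+1)})=(\mu^{(k)},L^{(k)})$ if $\widetilde{\mathcal{O}}(z^{(k+1)},\mu^{(k)})-\widetilde{\mathcal{O}}(z^{(k)},\mu^{(k)})<-\tau_2\mu^{(k)}/L^{(k)}$,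 and $(\mu^{(k+1)},L^{(k+1)})=(\tau_1\mu^{(k)},\tau_3L^{(k)})$ otherwise. *)

(* Defs.v *)
From HB Require Import structures.
From mathcomp Require Import all_boot all_order all_algebra.
From mathcomp Require Import all_classical all_reals all_analysis.
Unset Printing Implicit Defensive.
Import Order.TTheory GRing.Theory Num.Theory.
Local Open Scope ring_scope.

(* The variable z = (vec(W); b1; b2; vec(V)) in R^{N2},
   N2 = N0*N1 + N1 + N0 + N*N1, stored as a row vector.
   vec = columnwise vectorization: vec(W) = mxvec(W^T) (mxvec is row-major). *)
Notation zvec R N N0 N1 := 'rV[R]_(N0 * N1 + N1 + N0 + N * N1).

Definition N2 (N N0 N1 : nat) : nat := (N0 * N1 + N1 + N0 + N * N1)%N.

Section Defs.
Context {R : realType}.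

Definition zW {N N0 N1 : nat} (z : zvec R N N0 N1) : 'M[R]_(N1, N0) :=
  (vec_mx (lsubmx (lsubmx (lsubmx z))) : 'M[R]_(N0, N1))^T.
Definition zb1 {N N0 N1 : nat} (z : zvec R N N0 N1) : 'cV[R]_N1 :=
  (rsubmx (lsubmx (lsubmx z)))^T.
Definition zb2 {N N0 N1 : nat} (z : zvec R N N0 N1) : 'cV[R]_N0 :=
  (rsubmx (lsubmx z))^T.
Definition zV {N N0 N1 : nat} (z : zvec R N N0 N1) : 'M[R]_(N1, N) :=
  (vec_mx (rsubmx z) : 'M[R]_(N, N1))^T.

Definition pos {m : nat} (y : 'cV[R]_m) : 'cV[R]_m := map_mx (fun a => Num.max a 0) y.
Definition sqn2 {m : nat} (y : 'cV[R]_m) : R := \sum_(i < m) y i 0 ^+ 2.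
Definition esum {m : nat} (y : 'cV[R]_m) : R := \sum_(i < m) y i 0.
Definition frob2 {m n : nat} (A : 'M[R]_(m, n)) : R := \sum_(i < m) \sum_(j < n) A i j ^+ 2.
Definition norm1 {m n : nat} (A : 'M[R]_(m, n)) : R :=
  \big[Num.max/0]_(j < n) \sum_(i < m) `|A i j|.

Definition ip {k : nat} (u v : 'rV[R]_k) : R := \sum_(j < k) u 0 j * v 0 j.
Definition rsqn {k : nat} (u : 'rV[R]_k) : R := \sum_(j < k) u 0 j ^+ 2.

Definition Fobj {N N0 N1 : nat} (X : 'M[R]_(N0, N)) (z : zvec R N N0 N1) : R :=
  N%:R^-1 * \sum_(n < N)
     sqn2 (pos ((zW z)^T *m col n (zV z) + zb2 z) - col n X).
Definition Robj {N N0 N1 : nat} (lam1 lam2 : R) (z : zvec R N N0 N1) : R :=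
  lam1 * \sum_(n < N) esum (col n (zV z)) + lam2 * frob2 (zW z).
Definition Pobj {N N0 N1 : nat} (X : 'M[R]_(N0, N)) (beta : R) (z : zvec R N N0 N1) : R :=
  beta * \sum_(n < N) esum (col n (zV z) - pos (zW z *m col n X + zb1 z)).
Definition Oobj {N N0 N1 : nat} (X : 'M[R]_(N0, N)) (lam1 lam2 beta : R)
  (z : zvec R N N0 N1) : R :=
  Fobj X z + Robj lam1 lam2 z + Pobj X beta z.

Definition Omega2 {N N0 N1 : nat} (X : 'M[R]_(N0, N)) (z : zvec R N N0 N1) : Prop :=
  forall (n : 'I_N) (i : 'I_N1), pos (zW z *m col n X + zb1 z) i 0 <= col n (zV z) i 0.
Definition Omega3 {N N0 N1 : nat} (alpha : R) (z : zvec R N N0 N1) : Prop :=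
  (forall i : 'I_N1, `|zb1 z i 0| <= alpha) /\ (forall j : 'I_N0, `|zb2 z j 0| <= alpha).
Definition Zset {N N0 N1 : nat} (X : 'M[R]_(N0, N)) (alpha : R) (z : zvec R N N0 N1) : Prop :=
  Omega2 X z /\ Omega3 alpha z.
Definition Omega_theta {N N0 N1 : nat} (X : 'M[R]_(N0, N)) (lam1 lam2 beta theta : R)
  (z : zvec R N N0 N1) : Prop :=
  Omega2 X z /\ Oobj X lam1 lam2 beta z <= theta.

Definition alpha_c (N1 : nat) {N N0 : nat} (X : 'M[R]_(N0, N)) (lam1 lam2 theta : R) : R :=
  Num.max (theta / lam1 + Num.sqrt ((N1 * N0)%:R * theta / lam2) * norm1 X)
          (theta * Num.sqrt ((N1 * N0)%:R * theta) / (lam1 * Num.sqrt lam2)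
             + Num.sqrt (N%:R * theta) + norm1 X).
Definition eta_c (N0 N1 : nat) (lam1 lam2 theta : R) : R :=
  Num.max (Num.sqrt ((N1 * N0)%:R * theta / lam2)) (theta / lam1).

Definition sigt (mu a : R) : R :=
  if a < 0 then 0 else if a <= mu then a ^+ 2 / (2 * mu) else a - mu / 2.
Definition sigtv {m : nat} (y : 'cV[R]_m) (mu : R) : 'cV[R]_m := map_mx (sigt mu) y.

Definition Ftil {N N0 N1 : nat} (X : 'M[R]_(N0, N)) (z : zvec R N N0 N1) (mu : R) : R :=
  N%:R^-1 * \sum_(n < N) sqn2 (pos ((zW z)^T *m col n (zV z) + zb2 z))
  + N%:R^-1 * frob2 X
  - 2 / N%:R * \sum_(n < N)
       ((col n X)^T *m sigtv ((zW z)^T *m col n (zV z) + zb2 z) mu) 0 0.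
Definition Ptil {N N0 N1 : nat} (X : 'M[R]_(N0, N)) (beta : R) (z : zvec R N N0 N1) (mu : R) : R :=
  beta * \sum_(n < N) esum (col n (zV z) - sigtv (zW z *m col n X + zb1 z) mu).
Definition Htil {N N0 N1 : nat} (X : 'M[R]_(N0, N)) (beta : R) (z : zvec R N N0 N1) (mu : R) : R :=
  Ftil X z mu + Ptil X beta z mu.
Definition Otil {N N0 N1 : nat} (X : 'M[R]_(N0, N)) (lam1 lam2 beta : R)
  (z : zvec R N N0 N1) (mu : R) : R :=
  Htil X beta z mu + Robj lam1 lam2 z.

(* gradient w.r.t. z: the vector of partial derivatives
   (H~(.,mu) is continuously differentiable in z) *)
Definition gradz {k : nat} (f : 'rV[R]_k -> R) (z : 'rV[R]_k) : 'rV[R]_k :=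
  \row_(j < k) derive1 (fun t : R => f (z + t *: delta_mx 0 j)) 0.

Definition dist_zmu {k : nat} (z z' : 'rV[R]_k) (mu mu' : R) : R :=
  Num.sqrt (rsqn (z - z') + (mu - mu') ^+ 2).

Definition spg_sub {N N0 N1 : nat} (X : 'M[R]_(N0, N)) (lam1 lam2 beta : R)
  (zk : zvec R N N0 N1) (muk Lk : R) (z : zvec R N N0 N1) : R :=
  ip (gradz (fun y => Htil X beta y muk) zk) (z - zk) + Robj lam1 lam2 z
  + Lk / 2 * rsqn (z - zk).

End Defs.

(* Main.v *)
(* Everything follows once the iterates are known to be bounded.  Test the minimality of
   z^(k+1) against its rescaling (1-t)W, (1-t)b1, (1-2t)b2, (1-t)V, which stays in Z: the
   penalty P~ has a nonnegative radial derivative on Omega2, and W^T v + b2 is homogeneous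
   of degree two.  With M = |W|^2 + |b1|^2 + 2|b2|^2 + |V|^2 this gives
     (L/2) (M(z^(k+1)) - M(z^k)) <= 3 theta - 2 lam2 |W|^2 - lam1 e^T V,
   provided L >= (3/4) ((|V|^2 + |W|^2)/N + 2), so M stays below
   9 eta^2 + (N1 + 2 N0) alpha^2 as long as L is large enough on this sublevel set.
   Evaluating mu grad H~ near a corner of the box shows that its Lipschitz constant, hence
   every L^(k), is that large.
   On a bounded set a step has length O(1/L) and Otil(., mu) is Lipschitz uniformly in mu, so
   at a reduction of mu the value Otil increases by O(1/L^(k)) = O(mu^(k)), because
   mu^(k) L^(k) >= mu^(0) L^(0).  Hence Otil(z^k, mu^k) + C mu^k is nonincreasing for a
   suitable C.  Finally mu^(k) -> 0, since otherwise Otil would eventually decrease by a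
   fixed amount at every step while being nonnegative. *)
Require Import Defs.
From HB Require Import structures.
From mathcomp Require Import all_boot all_order all_algebra.
From mathcomp Require Import all_classical all_reals all_analysis.
From mathcomp Require Import ring lra.
Import Order.TTheory GRing.Theory Num.Theory numFieldNormedType.Exports.
Local Open Scope classical_set_scope.
Local Open Scope ring_scope.

(** The gradient of H~ is taken at z^k but paired with the radial field of z^(k+1). By homogeneity
    of W^T v + b2 the mismatch is linear in d = z^(k+1) - z^k, and Young's inequality absorbs it in
    the term (L/2) M(d) left over by polarizing M; the condition on L is the price. The Lipschitz
    constant of mu grad H~ is given only on the box of half-width a = max(alpha, 2 eta), which does
    not contain the sublevel set of M, so the estimate cannot be applied directly at the iterates.
    It enters only through the size of its constant. Points with constant blocks reduce that size to
    an inequality in four real variables w, v, b, mu. As mu stays below 1, the bound is obtained in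
    the limit mu -> 1, and two cases arise according to whether the residual N1 a^2 + a at the
    corner reaches 1. *)

Local Notation pp a := (Num.max a 0).

(** * Smoothed ReLU *)
Section Smoothing.
Context {R : realType}.
Implicit Types (m a b h x : R).


Definition dsigt m a : R := if a < 0 then 0 else if a <= m then a / m else 1.

Lemma pos_cases a : (a <= 0 /\ pp a = 0) \/ (0 <= a /\ pp a = a).
Proof. by case: (leP a 0) => h; [left|right; split=> //; exact: ltW]. Qed.

Lemma pos_ge0 a : 0 <= pp a.
Proof. by rewrite le_max lexx orbT. Qed.

Lemma pos_lip a b : `|pp a - pp b| <= `|a - b|.
Proof.
have [[ha ->]|[ha ->]] := pos_cases a; have [[hb ->]|[hb ->]] := pos_cases b => //.
- by rewrite subrr normr0.
- by rewrite sub0r normrN ger0_norm // distrC ger0_norm; lra.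
- by rewrite subr0 !ger0_norm; lra.
Qed.

(** As a difference of two squared positive parts, the piecewise function inherits differentiability
    at the kinks 0 and [m] from the C^1 function y -> (y)_+^2. *)
Lemma sigtE m a : 0 < m -> sigt m a = (pp a ^+ 2 - pp (a - m) ^+ 2) / (2 * m).
Proof.
move=> m0; rewrite /sigt; have m1 : m != 0 by rewrite gt_eqF.
case: ltP => [a0|a0].
  by rewrite ?max_r ?expr0n ?subr0 ?mul0r //; lra.
case: (leP a m) => [am|am].
  by rewrite max_r ?expr0n ?subr0 //; lra.
by rewrite ?max_l //; [field|lra].
Qed.

Lemma dsigtE m a : 0 < m -> dsigt m a = (pp a - pp (a - m)) / m.
Proof.
move=> m0; rewrite /dsigt; have m1 : m != 0 by rewrite gt_eqF.
case: ltP => [a0|a0].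
  by rewrite ?max_r ?subr0 ?mul0r //; lra.
case: (leP a m) => [am|am].
  by rewrite max_r ?subr0 //; lra.
by rewrite ?max_l //; [field|lra].
Qed.

Lemma dsigt_ge0 m a : 0 < m -> 0 <= dsigt m a.
Proof.
by move=> m0; rewrite /dsigt; case: ltP => // a0; case: (leP a m) => _; [rewrite divr_ge0 // ltW|exact: ler01].
Qed.

Lemma dsigt_le1 m a : 0 < m -> dsigt m a <= 1.
Proof.
move=> m0; rewrite /dsigt; case: ltP => // a0; case: (leP a m) => // am.
by rewrite ler_pdivrMr // mul1r.
Qed.


Lemma sigt_ge0 m a : 0 < m -> 0 <= sigt m a.
Proof.
move=> m0; rewrite /sigt; case: ltP => // a0; case: (leP a m) => am; last by lra.
by rewrite divr_ge0 ?sqr_ge0 //; lra.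
Qed.

Lemma sigt_le_pos m a : 0 < m -> sigt m a <= pp a.
Proof.
move=> m0; rewrite /sigt; case: ltP => a0 //; case: (leP a m) => am; last by lra.
by rewrite ler_pdivrMr; nra.
Qed.

Lemma pos_sub_sigt_le m a : 0 < m -> pp a - sigt m a <= m / 2.
Proof.
move=> m0; rewrite /sigt; case: ltP => a0; first by lra.
case: (leP a m) => am; last by lra.
have -> : a ^+ 2 / (2 * m) = m / 2 - (m - a) + (m - a) ^+ 2 / (2 * m).
  by field; rewrite gt_eqF.
suff : 0 <= (m - a) ^+ 2 / (2 * m) by lra.
by rewrite divr_ge0 ?sqr_ge0 //; lra.
Qed.

Lemma sigt_lip m a b : 0 < m -> `|sigt m a - sigt m b| <= `|a - b|.
Proof.
move=> m0; wlog ab : a b / a <= b.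
  move=> H; have [/H //|/ltW /H] := leP a b.
  by rewrite distrC (distrC b).
suff : 0 <= sigt m b - sigt m a <= b - a.
  by move=> /andP[h1 h2]; rewrite distrC ger0_norm // distrC ger0_norm //; lra.
rewrite !sigtE // -mulrBl; set c := (_ - _ - _).
have m2 : 0 < 2 * m by lra.
rewrite divr_ge0 ?ler_pdivrMr ?(ltW m2) //= {}/c.
  have [[h1 ->]|[h1 ->]] := pos_cases a; have [[h2 ->]|[h2 ->]] := pos_cases b;
  have [[h3 ->]|[h3 ->]] := pos_cases (a - m);
  have [[h4 ->]|[h4 ->]] := pos_cases (b - m); rewrite ?expr0n /=; nra.
have [[h1 ->]|[h1 ->]] := pos_cases a; have [[h2 ->]|[h2 ->]] := pos_cases b;
have [[h3 ->]|[h3 ->]] := pos_cases (a - m);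
have [[h4 ->]|[h4 ->]] := pos_cases (b - m); rewrite ?expr0n /=; nra.
Qed.

(** A quadratic remainder bound holds across the kinks of the functions below, so one-sided
    derivatives never have to be compared. *)
Lemma is_derive_quadratic (f : R -> R) a (l C : R) :
  (forall h, `|f (a + h) - f a - l * h| <= C * h ^+ 2) -> is_derive a 1 f l.
Proof.
move=> H.
have H0 : (fun h : R => h^-1 *: (f (h *: (1:R) + a) - f a)) @ 0^' --> l.
  apply/cvgrPdist_le => e e0.
  have d0 : 0 < e / (`|C| + 1) by rewrite divr_gt0 // ltr_wpDl.
  near=> h.
  have h0 : h != 0 by near: h; exact: nbhs_dnbhs_neq.
  have hd : `|h| <= e / (`|C| + 1).
    by near: h; exact: dnbhs0_le.
  rewrite /= [_ *: 1]mulr1 [h + a]addrC distrC.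
  have -> : h^-1 *: (f (a + h) - f a) - l = h^-1 * (f (a + h) - f a - l * h).
    by rewrite /GRing.scale /=; field.
  rewrite normrM normfV ler_pdivrMl ?normr_gt0 //.
  apply: (le_trans (H h)); rewrite -real_normK ?num_real //.
  apply: (@le_trans _ _ (`|C| * `|h| ^+ 2)).
    by rewrite ler_wpM2r ?sqr_ge0 // ler_norm.
  rewrite expr2 mulrCA ler_wpM2l //.
  apply: (@le_trans _ _ (`|C| * (e / (`|C| + 1)))).
    by rewrite ler_wpM2l.
  rewrite mulrCA ger_pMr // ler_pdivrMr ?ltr_wpDl // mul1r; lra.
split; first by apply/cvg_ex; exists l; exact: H0.
by apply/cvg_lim => //; exact: H0.
Unshelve. all: by end_near. Qed.

Lemma sqpos_quadratic a h :
  `|pp (a + h) ^+ 2 - pp a ^+ 2 - 2 * pp a * h| <= h ^+ 2.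
Proof.
rewrite ler_norml.
have [[h1 ->]|[h1 ->]] := pos_cases a; have [[h2 ->]|[h2 ->]] := pos_cases (a + h);
rewrite ?expr0n /=; apply/andP; split; nra.
Qed.

Lemma is_derive_sqpos a : is_derive a 1 (fun y : R => pp y ^+ 2) (2 * pp a).
Proof.
by apply: (@is_derive_quadratic _ _ _ 1) => h; rewrite mul1r; exact: sqpos_quadratic.
Qed.

Lemma is_derive_sigt m a : 0 < m -> is_derive a 1 (sigt m) (dsigt m a).
Proof.
(* Each of the two squares has remainder at most h^2; division by 2 m gives the constant 1/m. *)
move=> m0; apply: (@is_derive_quadratic _ _ _ m^-1) => h; rewrite !sigtE // dsigtE //.
have m1 : m != 0 by rewrite gt_eqF.
have -> : a + h - m = a - m + h by ring.
have := sqpos_quadratic a h; have := sqpos_quadratic (a - m) h.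
rewrite !ler_norml => /andP[h1 h2] /andP[h3 h4].
set u := pp (a + h) in h3 h4 *; set v := pp (a - m + h) in h1 h2 *.
set w := pp a in h3 h4 *; set s := pp (a - m) in h1 h2 *.
set E := (X in _ <= X <= _).
have -> : E = ((u ^+ 2 - w ^+ 2 - 2 * w * h) - (v ^+ 2 - s ^+ 2 - 2 * s * h)) / (2 * m).
  by rewrite /E; field.
have -> : m^-1 * h ^+ 2 = (2 * h ^+ 2) / (2 * m) by field.
by rewrite -mulNr !ler_pM2r ?invr_gt0; try lra; apply/andP; split; lra.
Qed.

End Smoothing.

(** * Coordinates of the variable *)
Section Coordinates.
Context {R : realType} {N N0 N1 : nat}.
Implicit Types (z d u v : zvec R N N0 N1).

Definition mkz (W : 'M[R]_(N1, N0)) (b1 : 'cV[R]_N1) (b2 : 'cV[R]_N0)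
    (V : 'M[R]_(N1, N)) : zvec R N N0 N1 :=
  row_mx (row_mx (row_mx (mxvec W^T) b1^T) b2^T) (mxvec V^T).

Lemma zW_mkz W b1 b2 V : zW (mkz W b1 b2 V) = W.
Proof. by rewrite /zW /mkz !row_mxKl mxvecK trmxK. Qed.
Lemma zb1_mkz W b1 b2 V : zb1 (mkz W b1 b2 V) = b1.
Proof. by rewrite /zb1 /mkz !row_mxKl row_mxKr trmxK. Qed.
Lemma zb2_mkz W b1 b2 V : zb2 (mkz W b1 b2 V) = b2.
Proof. by rewrite /zb2 /mkz row_mxKl row_mxKr trmxK. Qed.
Lemma zV_mkz W b1 b2 V : zV (mkz W b1 b2 V) = V.
Proof. by rewrite /zV /mkz row_mxKr mxvecK trmxK. Qed.

Lemma mkzK z : mkz (zW z) (zb1 z) (zb2 z) (zV z) = z.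
Proof. by rewrite /mkz !trmxK !vec_mxK !hsubmxK. Qed.

Lemma zW_lin (a : R) u v i j : zW (a *: u + v) i j = a * zW u i j + zW v i j.
Proof. by rewrite /zW !linearP !mxE. Qed.
Lemma zb1_lin (a : R) u v i : zb1 (a *: u + v) i 0 = a * zb1 u i 0 + zb1 v i 0.
Proof. by rewrite /zb1 !linearP !mxE. Qed.
Lemma zb2_lin (a : R) u v i : zb2 (a *: u + v) i 0 = a * zb2 u i 0 + zb2 v i 0.
Proof. by rewrite /zb2 !linearP !mxE. Qed.
Lemma zV_lin (a : R) u v i j : zV (a *: u + v) i j = a * zV u i j + zV v i j.
Proof. by rewrite /zV !linearP !mxE. Qed.

Lemma zW_line (a : R) u v i j : zW (u + a *: v) i j = zW u i j + a * zW v i j.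
Proof. by rewrite addrC zW_lin addrC. Qed.
Lemma zb1_line (a : R) u v i : zb1 (u + a *: v) i 0 = zb1 u i 0 + a * zb1 v i 0.
Proof. by rewrite addrC zb1_lin addrC. Qed.
Lemma zb2_line (a : R) u v i : zb2 (u + a *: v) i 0 = zb2 u i 0 + a * zb2 v i 0.
Proof. by rewrite addrC zb2_lin addrC. Qed.
Lemma zV_line (a : R) u v i j : zV (u + a *: v) i j = zV u i j + a * zV v i j.
Proof. by rewrite addrC zV_lin addrC. Qed.

Lemma zWB u v i j : zW (u - v) i j = zW u i j - zW v i j.
Proof. by rewrite -scaleN1r zW_line mulN1r. Qed.
Lemma zb1B u v i : zb1 (u - v) i 0 = zb1 u i 0 - zb1 v i 0.
Proof. by rewrite -scaleN1r zb1_line mulN1r. Qed.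
Lemma zb2B u v i : zb2 (u - v) i 0 = zb2 u i 0 - zb2 v i 0.
Proof. by rewrite -scaleN1r zb2_line mulN1r. Qed.
Lemma zVB u v i j : zV (u - v) i j = zV u i j - zV v i j.
Proof. by rewrite -scaleN1r zV_line mulN1r. Qed.

Lemma sum_mxvec (m n : nat) (f : 'rV[R]_(m * n) -> 'I_(m * n) -> R) (A : 'M[R]_(m, n)) :
  \sum_k f (mxvec A) k = \sum_i \sum_j f (mxvec A) (mxvec_index i j).
Proof.
rewrite pair_big /= (reindex _ (curry_mxvec_bij _ _)) /=.
by apply: eq_bigr => -[i j] _.
Qed.

Lemma ipE u v : ip u v =
  \sum_i \sum_j zW u i j * zW v i j + \sum_i zb1 u i 0 * zb1 v i 0
  + \sum_j zb2 u j 0 * zb2 v j 0 + \sum_i \sum_n zV u i n * zV v i n.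
Proof.
rewrite -{1}(mkzK u) -{1}(mkzK v) /ip /mkz.
rewrite big_split_ord /=; congr (_ + _); last first.
  under eq_bigr do rewrite !row_mxEr.
  rewrite (@sum_mxvec _ _ (fun A k => A 0 k * mxvec (zV v)^T 0 k)) exchange_big /=.
  by apply: eq_bigr => i _; apply: eq_bigr => j _; rewrite !mxvecE !mxE.
rewrite big_split_ord /=; congr (_ + _); last first.
  by apply: eq_bigr => j _; rewrite !row_mxEl !row_mxEr !mxE.
rewrite big_split_ord /=; congr (_ + _); last first.
  by apply: eq_bigr => j _; rewrite !row_mxEl !row_mxEr !mxE.
under eq_bigr do rewrite !row_mxEl.
rewrite (@sum_mxvec _ _ (fun A k => A 0 k * mxvec (zW v)^T 0 k)) exchange_big /=.
by apply: eq_bigr => i _; apply: eq_bigr => j _; rewrite !mxvecE !mxE.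
Qed.

Lemma rsqn_ip (k : nat) (u : 'rV[R]_k) : rsqn u = ip u u.
Proof. by apply: eq_bigr => j _; rewrite expr2. Qed.

Lemma mkz_entry_le (c : R) (W : 'M[R]_(N1, N0)) (b1 : 'cV[R]_N1)
    (b2 : 'cV[R]_N0) (V : 'M[R]_(N1, N)) :
  (forall i j, `|W i j| <= c) -> (forall i, `|b1 i 0| <= c) ->
  (forall j, `|b2 j 0| <= c) -> (forall i n, `|V i n| <= c) ->
  forall k, `|mkz W b1 b2 V 0 k| <= c.
Proof.
move=> hW h1 h2 hV k; rewrite /mkz mxE; case: (fintype.split k) => [{}k|{}k]; last first.
  by case/mxvec_indexP: k => i j; rewrite mxvecE mxE.
rewrite mxE; case: (fintype.split k) => [{}k|{}k]; last by rewrite mxE.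
rewrite mxE; case: (fintype.split k) => [{}k|{}k]; last by rewrite mxE.
by case/mxvec_indexP: k => i j; rewrite mxvecE mxE.
Qed.

End Coordinates.

(** * The objective and its gradient *)
Section Objective.
Context {R : realType} {N N0 N1 : nat}.
Context (X : 'M[R]_(N0, N)) (beta : R).
Implicit Types (z d u v : zvec R N N0 N1) (m t : R).

Definition res z (n : 'I_N) (j : 'I_N0) : R :=
  \sum_i zW z i j * zV z i n + zb2 z j 0.
Definition pre z (n : 'I_N) (i : 'I_N1) : R :=
  \sum_j zW z i j * X j n + zb1 z i 0.
(** The differential of [res] at [z] along [d]. Since [res] is quadratic, the expansion in
    [res_line] is exact. *)
Definition dres z d (n : 'I_N) (j : 'I_N0) : R :=
  \sum_i (zW d i j * zV z i n + zW z i j * zV d i n) + zb2 d j 0.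

Lemma resP z n j : ((zW z)^T *m col n (zV z) + zb2 z) j 0 = res z n j.
Proof.
rewrite /res mxE [X in X + _]mxE; congr (_ + _); apply: eq_bigr => i _.
by rewrite [_^T _ _]mxE [col _ _ _ _]mxE.
Qed.

Lemma preP z n i : (zW z *m col n X + zb1 z) i 0 = pre z n i.
Proof.
rewrite /pre mxE [X in X + _]mxE; congr (_ + _); apply: eq_bigr => j _.
by rewrite [col _ _ _ _]mxE.
Qed.

Definition Hval m z : R :=
  N%:R^-1 * \sum_n \sum_j
     (pp (res z n j) ^+ 2 + X j n ^+ 2 - 2 * X j n * sigt m (res z n j))
  + beta * \sum_n \sum_i (zV z i n - sigt m (pre z n i)).

Lemma HtilE m z : Htil X beta z m = Hval m z.
Proof.
rewrite /Htil /Ftil /Ptil /Hval; congr (_ + _ * _); last first.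
  apply: eq_bigr => n _; rewrite /Defs.esum; apply: eq_bigr => i _.
  by rewrite -preP mxE [X in X + _]mxE [X in _ + X]mxE [X in _ - X]mxE.
rewrite [2 / _]mulrC -mulrA -mulrDr -mulrBr; congr (_ * _).
rewrite /frob2 [X in _ + X - _]exchange_big /= mulr_sumr -big_split -sumrB /=.
apply: eq_bigr => n _; rewrite mxE mulr_sumr /sqn2 -big_split -sumrB /=.
apply: eq_bigr => j _.
rewrite [pos _ _ _]mxE [sigtv _ _ _ _]mxE !resP [(col n X)^T _ _]mxE [col _ _ _ _]mxE.
by rewrite mulrA.
Qed.

Lemma RobjE lam1 lam2 z : Robj lam1 lam2 z =
  lam1 * (\sum_n \sum_i zV z i n) + lam2 * (\sum_i \sum_j zW z i j ^+ 2).
Proof.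
rewrite /Robj; congr (_ * _ + _); apply: eq_bigr => n _; rewrite /Defs.esum.
apply: eq_bigr => i _.
by rewrite mxE.
Qed.

Lemma OtilE lam1 lam2 m z :
  Otil X lam1 lam2 beta z m = Hval m z + Robj lam1 lam2 z.
Proof. by rewrite /Otil HtilE. Qed.

Lemma OobjE lam1 lam2 z : Oobj X lam1 lam2 beta z =
  N%:R^-1 * (\sum_n \sum_j (pp (res z n j) - X j n) ^+ 2) + Robj lam1 lam2 z
  + beta * \sum_n \sum_i (zV z i n - pp (pre z n i)).
Proof.
rewrite /Oobj /Fobj /Pobj; congr (_ * _ + _ + _ * _).
  apply: eq_bigr => n _; rewrite /sqn2; apply: eq_bigr => j _.
  by rewrite -resP mxE [X in X + _]mxE [X in _ + X]mxE [X in _ - X]mxE.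
apply: eq_bigr => n _; rewrite /Defs.esum; apply: eq_bigr => i _.
by rewrite -preP mxE [X in X + _]mxE [X in _ + X]mxE [X in _ - X]mxE.
Qed.

Lemma Omega2P z : Omega2 X z <-> forall n i, pp (pre z n i) <= zV z i n.
Proof.
by split=> H n i; have := H n i; rewrite -preP [pos _ _ _]mxE [col _ _ _ _]mxE.
Qed.

Lemma pre_lin t u v n i : pre (t *: u + v) n i = t * pre u n i + pre v n i.
Proof.
rewrite /pre zb1_lin mulrDr addrACA; congr (_ + _).
rewrite mulr_sumr -big_split; apply: eq_bigr => j _ /=.
by rewrite zW_lin mulrDl mulrA.
Qed.

Lemma pre_line t u v n i : pre (u + t *: v) n i = pre u n i + t * pre v n i.
Proof. by rewrite addrC pre_lin addrC. Qed.

Lemma dres_lin z t u v n j : dres z (t *: u + v) n j = t * dres z u n j + dres z v n j.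
Proof.
rewrite /dres zb2_lin mulrDr addrACA; congr (_ + _).
rewrite mulr_sumr -big_split; apply: eq_bigr => i _ /=.
by rewrite zW_lin zV_lin; ring.
Qed.

Lemma res_line z d t n j : res (z + t *: d) n j =
  res z n j + t * dres z d n j + t ^+ 2 * \sum_i zW d i j * zV d i n.
Proof.
rewrite /res /dres zb2_line mulrDr !mulr_sumr addrAC.
rewrite [RHS](_ : _ = (\sum_i zW z i j * zV z i n
  + \sum_i t * (zW d i j * zV z i n + zW z i j * zV d i n)
  + \sum_i t ^+ 2 * (zW d i j * zV d i n)) + zb2 z j 0 + t * zb2 d j 0); last by ring.
rewrite -!big_split /= addrA; congr (_ + _ + _); apply: eq_bigr => i _.
by rewrite zW_line zV_line; ring.
Qed.

(** Half the derivative of r -> (r)_+^2 - 2 x sigma~(r, m) at the residual; the factor 2 is kept in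
    [dF]. *)
Definition rho m z n j : R := pp (res z n j) - X j n * dsigt m (res z n j).

Definition dF m z d : R := 2 / N%:R * \sum_n \sum_j rho m z n j * dres z d n j.
Definition dP m z d : R :=
  beta * \sum_n \sum_i (zV d i n - dsigt m (pre z n i) * pre d n i).
Definition dH m z d : R := dF m z d + dP m z d.

Lemma dF_lin m z t u v : dF m z (t *: u + v) = t * dF m z u + dF m z v.
Proof.
rewrite /dF mulrCA -mulrDr; congr (_ * _).
rewrite mulr_sumr -big_split; apply: eq_bigr => n _ /=.
rewrite mulr_sumr -big_split; apply: eq_bigr => j _ /=.
by rewrite dres_lin; ring.
Qed.

Lemma dP_lin m z t u v : dP m z (t *: u + v) = t * dP m z u + dP m z v.
Proof.
rewrite /dP mulrCA -mulrDr; congr (_ * _).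
rewrite mulr_sumr -big_split; apply: eq_bigr => n _ /=.
rewrite mulr_sumr -big_split; apply: eq_bigr => j _ /=.
by rewrite zV_lin pre_lin; ring.
Qed.

Lemma dH_lin m z t u v : dH m z (t *: u + v) = t * dH m z u + dH m z v.
Proof. by rewrite /dH dF_lin dP_lin mulrDr addrACA. Qed.

Lemma is_derive_comp_line (f : R -> R) (a b c l : R) : is_derive a 1 f l ->
  is_derive (0 : R) 1 (fun t : R => f (a + t * b + t ^+ 2 * c)) (b * l).
Proof.
move=> fl.
have H : is_derive (0 : R) 1 (fun t : R => a + t * b + t ^+ 2 * c) b.
  apply: (@is_derive_quadratic _ _ _ _ `|c|) => h; set E := (X in `|X|).
  have -> : E = c * h ^+ 2 by rewrite /E; ring.
  by rewrite normrM (ger0_norm (sqr_ge0 h)).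
have fl' : is_derive ((fun t : R => a + t * b + t ^+ 2 * c) 0) 1 f l.
  by rewrite /= mul0r expr0n mul0r !addr0.
have := @is_derive1_comp _ f (fun t : R => a + t * b + t ^+ 2 * c) 0 l b fl' H.
by rewrite /GRing.scale /= mulrC.
Qed.

Lemma is_derive_Hval m z d : 0 < m ->
  is_derive (0 : R) 1 (fun t : R => Hval m (z + t *: d)) (dH m z d).
Proof.
move=> m0.
pose f1 n j : R -> R := fun t => pp (res (z + t *: d) n j) ^+ 2.
pose f2 n j : R -> R := fun t => sigt m (res (z + t *: d) n j).
pose f3 n i : R -> R := fun t => sigt m (pre (z + t *: d) n i).
have D1 n j : is_derive (0 : R) 1 (f1 n j) (dres z d n j * (2 * pp (res z n j))).
  rewrite /f1; under eq_fun do rewrite res_line.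
  exact: (@is_derive_comp_line (fun y => pp y ^+ 2) _ (dres z d n j)
    (\sum_i zW d i j * zV d i n) _ (is_derive_sqpos _)).
have D2 n j : is_derive (0 : R) 1 (f2 n j) (dres z d n j * dsigt m (res z n j)).
  rewrite /f2; under eq_fun do rewrite res_line.
  exact: (@is_derive_comp_line (sigt m) _ (dres z d n j)
    (\sum_i zW d i j * zV d i n) _ (is_derive_sigt m _ m0)).
have D3 n i : is_derive (0 : R) 1 (f3 n i) (pre d n i * dsigt m (pre z n i)).
  rewrite /f3; have := is_derive_comp_line _ _ (pre d n i) 0 _ (is_derive_sigt m (pre z n i) m0).
  by congr is_derive; apply/funext => t; rewrite pre_line mulr0 addr0.
have -> : (fun t : R => Hval m (z + t *: d)) =
  cst (N%:R^-1) * (\sum_n \sum_j (f1 n j + cst (X j n ^+ 2) - cst (2 * X j n) * f2 n j))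
  + cst beta * (\sum_n \sum_i (cst (zV z i n) + id * cst (zV d i n) - f3 n i)).
  apply/funext => t; rewrite /Hval /=.
  rewrite [in RHS]/GRing.add /= [in RHS]/GRing.mul /=.
  rewrite !fct_sumE; congr (_ * _ + _ * _); apply: eq_bigr => n _;
    rewrite !fct_sumE; apply: eq_bigr => j _ //=.
  by rewrite zV_line.
have E1 n j : is_derive (0 : R) 1 (f1 n j + cst (X j n ^+ 2) - cst (2 * X j n) * f2 n j)
    (2 * (rho m z n j * dres z d n j)).
  have := is_deriveB (is_deriveD (D1 n j) (is_derive_cst (X j n ^+ 2) (0 : R) 1))
    (is_deriveM (is_derive_cst (2 * X j n) (0 : R) 1) (D2 n j)).
  by move=> /is_derive_eq; apply; rewrite /GRing.scale /= /rho /cst; ring.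
have E2 n i : is_derive (0 : R) 1 (cst (zV z i n) + id * cst (zV d i n) - f3 n i)
    (zV d i n - dsigt m (pre z n i) * pre d n i).
  have := is_deriveB (is_deriveD (is_derive_cst (zV z i n) (0 : R) 1)
    (is_deriveM (is_derive_id (0 : R) 1) (is_derive_cst (zV d i n) (0 : R) 1))) (D3 n i).
  by move=> /is_derive_eq; apply; rewrite /GRing.scale /= /cst; ring.
have := is_deriveD
  (is_deriveM (is_derive_cst (N%:R^-1 : R) (0 : R) 1)
     (is_derive_sum (fun n => is_derive_sum (E1 n))))
  (is_deriveM (is_derive_cst beta (0 : R) 1)
     (is_derive_sum (fun n => is_derive_sum (E2 n)))).
move=> /is_derive_eq; apply.
rewrite /GRing.scale /= /dH /dF /dP /cst; congr (_ + _).
  rewrite mulr0 addr0 -mulrA [RHS]mulrCA; congr (_ * _); rewrite mulr_sumr.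
  by apply: eq_bigr => n _; rewrite mulr_sumr.
by rewrite [X in _ + X = _]mulr0 [LHS]addr0.
Qed.

(** [gradz] only records partial derivatives; [dH] is linear in the direction, so summing over unit
    vectors recovers every directional derivative. *)
Lemma ip_gradz m z d : 0 < m ->
  ip (gradz (fun y => Htil X beta y m) z) d = dH m z d.
Proof.
move=> m0.
have E j : gradz (fun y => Htil X beta y m) z 0 j = dH m z (delta_mx 0 j).
  rewrite mxE derive1E; under eq_fun do rewrite HtilE.
  by apply: derive_val; exact: is_derive_Hval.
rewrite /ip; under eq_bigr do rewrite E.
rewrite [in RHS](row_sum_delta d).
have H0 : dH m z 0 = 0.
  by have := dH_lin m z (-1) 0 0; rewrite scaler0 addr0; lra.
elim/big_rec2: _ => [|j y1 y2 _ IH]; first by rewrite H0.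
by rewrite dH_lin IH mulrC.
Qed.

End Objective.

(** * Radial variations *)
Section Radial.
Context {R : realType}.

(** Lagrange's identity: the double sum of (a_i b_j - a_j b_i)^2 is twice the gap between the two
    sides. *)
Lemma sum_CauchySchwarz (I : finType) (a b : I -> R) :
  (\sum_i a i * b i) ^+ 2 <= (\sum_i a i ^+ 2) * (\sum_i b i ^+ 2).
Proof.
have H : 0 <= \sum_i \sum_j (a i * b j - a j * b i) ^+ 2.
  by apply: sumr_ge0 => i _; apply: sumr_ge0 => j _; rewrite sqr_ge0.
suff E : \sum_i \sum_j (a i * b j - a j * b i) ^+ 2 =
    2 * ((\sum_i a i ^+ 2) * (\sum_i b i ^+ 2)) - 2 * (\sum_i a i * b i) ^+ 2.
  by rewrite E in H; lra.
have E1 : (\sum_i a i ^+ 2) * (\sum_i b i ^+ 2) = \sum_i \sum_j a i ^+ 2 * b j ^+ 2.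
  by rewrite mulr_suml; apply: eq_bigr => i _; rewrite mulr_sumr.
have E2 : (\sum_i a i ^+ 2) * (\sum_i b i ^+ 2) = \sum_i \sum_j a j ^+ 2 * b i ^+ 2.
  by rewrite E1 exchange_big.
have E3 : (\sum_i a i * b i) ^+ 2 = \sum_i \sum_j (a i * b i) * (a j * b j).
  by rewrite expr2 mulr_suml; apply: eq_bigr => i _; rewrite mulr_sumr.
rewrite [2 * (_ * _)]mulrDl mul1r {1}E1 E2 E3 mulr_sumr -big_split -sumrB /=.
apply: eq_bigr => i _; rewrite mulr_sumr -big_split -sumrB /=.
by apply: eq_bigr => j _; ring.
Qed.

Lemma young (L c x y : R) : 0 < L -> - (2 * c * x * y) <= L / 2 * x ^+ 2 + 2 * c ^+ 2 / L * y ^+ 2.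
Proof.
move=> L0; have -> : 2 * c ^+ 2 / L * y ^+ 2 = L / 2 * (2 * c * y / L) ^+ 2.
  by field; rewrite gt_eqF.
have -> : 2 * c * x * y = L * x * (2 * c * y / L) by field; rewrite gt_eqF.
set s := 2 * c * y / L; have : 0 <= L / 2 * (x + s) ^+ 2 by rewrite mulr_ge0 ?sqr_ge0 //; lra.
lra.
Qed.

(** The range of [t] stops at 1/2 because b2 is rescaled by 1 - 2 t, which [Zset_shrink] requires to
    be nonnegative. *)
Lemma le0_of_le_small (Q C : R) : (forall t, 0 < t <= 1 / 2 -> Q <= t * C) -> Q <= 0.
Proof.
move=> H; case: (leP Q 0) => // Q0.
have C1 : 0 < `|C| + 1 by rewrite ltr_wpDl.
pose t := Num.min (1 / 2) (Q / (2 * (`|C| + 1))).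
have t0 : 0 < t by rewrite lt_min divr_gt0 // ?divr_gt0 //; lra.
have tl : t <= Q / (2 * (`|C| + 1)) by rewrite ge_min lexx orbT.
have := H t; rewrite t0 ge_min lexx /= => /(_ isT) h.
have h1 : t * C <= t * (`|C| + 1).
  by rewrite ler_wpM2l ?(ltW t0) //; have := ler_norm C; lra.
have h2 : t * (`|C| + 1) <= Q / (2 * (`|C| + 1)) * (`|C| + 1).
  by rewrite ler_wpM2r ?(ltW C1).
have h3 : Q / (2 * (`|C| + 1)) * (`|C| + 1) = Q / 2 by field; rewrite gt_eqF.
lra.
Qed.

Context {N N0 N1 : nat}.
Context (X : 'M[R]_(N0, N)) (lam1 lam2 beta : R).
Implicit Types (z d u v : zvec R N N0 N1) (m t : R).

Definition sW z : R := \sum_i \sum_j zW z i j ^+ 2.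
Definition sb1 z : R := \sum_i zb1 z i 0 ^+ 2.
Definition sb2 z : R := \sum_j zb2 z j 0 ^+ 2.
Definition sV z : R := \sum_i \sum_n zV z i n ^+ 2.
Definition tV z : R := \sum_n \sum_i zV z i n.

Lemma sW_ge0 z : 0 <= sW z.
Proof. by apply: sumr_ge0 => i _; apply: sumr_ge0 => j _; rewrite sqr_ge0. Qed.
Lemma sV_ge0 z : 0 <= sV z.
Proof. by apply: sumr_ge0 => i _; apply: sumr_ge0 => j _; rewrite sqr_ge0. Qed.
Lemma sb1_ge0 z : 0 <= sb1 z.
Proof. by apply: sumr_ge0 => i _; rewrite sqr_ge0. Qed.
Lemma sb2_ge0 z : 0 <= sb2 z.
Proof. by apply: sumr_ge0 => i _; rewrite sqr_ge0. Qed.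

(* [b2] counts twice: [W^T v + b2] is then homogeneous of degree two under [radial]. *)
Definition lyap z : R := sW z + sb1 z + 2 * sb2 z + sV z.

(** Half the gradient of [lyap] at [z], so that [lyap_polar] is the polarization identity of this
    quadratic form. *)
Definition radial z : zvec R N N0 N1 := mkz (zW z) (zb1 z) (2 *: zb2 z) (zV z).

Lemma zb2_radial z j : zb2 (radial z) j 0 = 2 * zb2 z j 0.
Proof. by rewrite zb2_mkz mxE. Qed.

Lemma pre_radial z n i : pre X (radial z) n i = pre X z n i.
Proof. by rewrite /pre zW_mkz zb1_mkz. Qed.

Lemma lyap_polar u v : 2 * ip (u - v) (radial u) = lyap u - lyap v + lyap (u - v).
Proof.
rewrite ipE zW_mkz zb1_mkz zV_mkz /lyap.
have EW : 2 * (\sum_i \sum_j zW (u - v) i j * zW u i j) = sW u - sW v + sW (u - v).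
  rewrite /sW -sumrB -big_split mulr_sumr /=; apply: eq_bigr => i _.
  rewrite -sumrB -big_split mulr_sumr /=; apply: eq_bigr => j _.
  by rewrite zWB; ring.
have EV : 2 * (\sum_i \sum_j zV (u - v) i j * zV u i j) = sV u - sV v + sV (u - v).
  rewrite /sV -sumrB -big_split mulr_sumr /=; apply: eq_bigr => i _.
  rewrite -sumrB -big_split mulr_sumr /=; apply: eq_bigr => j _.
  by rewrite zVB; ring.
have E1 : 2 * (\sum_i zb1 (u - v) i 0 * zb1 u i 0) = sb1 u - sb1 v + sb1 (u - v).
  rewrite /sb1 -sumrB -big_split mulr_sumr /=; apply: eq_bigr => i _.
  by rewrite zb1B; ring.
have E2 : \sum_i zb2 (u - v) i 0 * zb2 (radial u) i 0 = sb2 u - sb2 v + sb2 (u - v).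
  rewrite /sb2 -sumrB -big_split /=; apply: eq_bigr => i _.
  by rewrite zb2_radial zb2B; ring.
by rewrite !mulrDr EW EV E1 E2; ring.
Qed.

Lemma spg_subE zk m L z : 0 < m ->
  spg_sub X lam1 lam2 beta zk m L z =
  dH X beta m zk (z - zk) + lam1 * tV z + lam2 * sW z + L / 2 * rsqn (z - zk).
Proof. by move=> m0; rewrite /spg_sub ip_gradz // RobjE /tV /sW addrA. Qed.

(** Omega2 is a cone in (W, b1, V) that does not involve b2, and Omega3 is convex and symmetric, so
    b2 may shrink twice as fast. *)
Lemma Zset_shrink al t z : 0 <= al -> 0 <= t <= 1 / 2 -> Zset X al z ->
  Zset X al (z + (- t) *: radial z).
Proof.
move=> al0 /andP[t0 t1] [/Omega2P H2 [H31 H32]]; split.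
  apply/Omega2P => n i; rewrite pre_line pre_radial zV_line zV_mkz.
  have -> : pre X z n i + - t * pre X z n i = (1 - t) * pre X z n i by ring.
  have -> : zV z i n + - t * zV z i n = (1 - t) * zV z i n by ring.
  have := H2 n i; have t2 : 0 <= 1 - t by lra.
  rewrite ge_max => /andP[h1 h2]; rewrite ge_max ler_wpM2l // mulr_ge0 //.
split=> j.
  rewrite zb1_line zb1_mkz.
  have -> : zb1 z j 0 + - t * zb1 z j 0 = (1 - t) * zb1 z j 0 by ring.
  have := H31 j; rewrite normrM (ger0_norm (_ : 0 <= 1 - t)); last by lra.
  by have := normr_ge0 (zb1 z j 0); nra.
rewrite zb2_line zb2_radial.
have -> : zb2 z j 0 + - t * (2 * zb2 z j 0) = (1 - 2 * t) * zb2 z j 0 by ring.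
have := H32 j; rewrite normrM (ger0_norm (_ : 0 <= 1 - 2 * t)); last by lra.
by have := normr_ge0 (zb2 z j 0); nra.
Qed.

Lemma rsqn_line t u v : rsqn (u + t *: v) = rsqn u + 2 * t * ip u v + t ^+ 2 * rsqn v.
Proof.
rewrite /rsqn /ip !mulr_sumr -!big_split; apply: eq_bigr => j _ /=.
by rewrite !mxE; ring.
Qed.

(** One-sided first-order condition along [- radial z]: after division by [t], the quadratic terms
    are [t] times the constant handed to [le0_of_le_small]. *)
Lemma radial_variation al zk m L z : 0 <= al -> 0 < m -> Zset X al z ->
  (forall y, Zset X al y -> spg_sub X lam1 lam2 beta zk m L z
                             <= spg_sub X lam1 lam2 beta zk m L y) ->
  dH X beta m zk (radial z) + lam1 * tV z + 2 * lam2 * sW z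
    + L * ip (z - zk) (radial z) <= 0.
Proof.
move=> al0 m0 Zz H.
apply: (@le0_of_le_small _ (lam2 * sW z + L / 2 * rsqn (radial z))) => t t01.
have t0 : 0 < t by case/andP: t01.
have t01' : 0 <= t <= 1 / 2 by case/andP: t01 => /ltW -> ->.
have := H _ (Zset_shrink _ _ _ al0 t01' Zz).
rewrite !spg_subE //.
have -> : z + - t *: radial z - zk = z - zk + (- t) *: radial z by rewrite addrAC.
rewrite rsqn_line [z - zk + _]addrC dH_lin.
have -> : tV (z + - t *: radial z) = (1 - t) * tV z.
  rewrite /tV mulr_sumr; apply: eq_bigr => n _; rewrite mulr_sumr; apply: eq_bigr => i _.
  by rewrite zV_line zV_mkz; ring.
have -> : sW (z + - t *: radial z) = (1 - t) ^+ 2 * sW z.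
  rewrite /sW mulr_sumr; apply: eq_bigr => n _; rewrite mulr_sumr; apply: eq_bigr => i _.
  by rewrite zW_line zW_mkz; ring.
set a := dH _ _ _ _ (radial z); set b := dH _ _ _ _ _; set c := tV z; set s := sW z.
set r := rsqn _; set i := ip _ _; set r' := rsqn _ => h.
rewrite -subr_ge0 -(pmulr_rge0 _ t0); lra.
Qed.

(** A slope in [0, 1] times the preactivation is at most its positive part, hence at most v on
    Omega2. The slopes may therefore be taken at an unrelated point [zk]. *)
Lemma dP_radial_ge0 m zk z : 0 <= beta -> 0 < m -> Omega2 X z ->
  0 <= dP X beta m zk (radial z).
Proof.
move=> b0 m0 /Omega2P H; apply: mulr_ge0 => //.
apply: sumr_ge0 => n _; apply: sumr_ge0 => i _; rewrite zV_mkz pre_radial.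
have := H n i; have := dsigt_ge0 m (pre X zk n i) m0.
have := dsigt_le1 m (pre X zk n i) m0.
rewrite ge_max; set s := dsigt _ _ => s1 s0 /andP[h1 h2].
have [hp|hp] := leP 0 (pre X z n i); nra.
Qed.

(** Euler's identity for degree two gives [2 * res v] for [dres v (radial v)]; [drad v (u - v)] is
    the correction when [radial] is taken at another point [u]. *)
Definition drad z d (n : 'I_N) (j : 'I_N0) : R :=
  \sum_i (zW d i j * zV z i n + zW z i j * zV d i n) + 2 * zb2 d j 0.

Lemma dres_radial u v n j :
  dres v (radial u) n j = 2 * res v n j + drad v (u - v) n j.
Proof.
rewrite /dres /drad /res zb2_radial zb2B zW_mkz zV_mkz.
have -> : \sum_i (zW u i j * zV v i n + zW v i j * zV u i n) =
   2 * (\sum_i zW v i j * zV v i n) + \sum_i (zW (u - v) i j * zV v i n + zW v i j * zV (u - v) i n).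
  rewrite mulr_sumr -big_split; apply: eq_bigr => i _ /=.
  by rewrite zWB zVB; ring.
ring.
Qed.

(** Grouped by the coordinates of [d], the sum is treated by Young's inequality per coordinate, and
    Cauchy-Schwarz bounds the squared coefficients: those of W contribute [sV z], those of V [sW z],
    and those of b2 the term 2 N. *)
Lemma young_drad (rh : 'I_N -> 'I_N0 -> R) (c L : R) z d : 0 < L ->
  - (2 * c * \sum_n \sum_j rh n j * drad z d n j) <=
  L / 2 * (sW d + sV d + 2 * sb2 d)
  + 2 * c ^+ 2 / L * ((sV z + sW z + 2 * N%:R) * \sum_n \sum_j rh n j ^+ 2).
Proof.
move=> L0; set S := \sum_n \sum_j rh n j ^+ 2.
have S0 : 0 <= 2 * c ^+ 2 / L by rewrite divr_ge0 ?(ltW L0) // mulr_ge0 ?sqr_ge0.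
have -> : \sum_n \sum_j rh n j * drad z d n j =
   \sum_i \sum_j zW d i j * (\sum_n rh n j * zV z i n)
 + \sum_i \sum_n zV d i n * (\sum_j rh n j * zW z i j)
 + \sum_j 2 * zb2 d j 0 * (\sum_n rh n j * 1).
  have -> : \sum_i \sum_j zW d i j * (\sum_n rh n j * zV z i n) =
            \sum_n \sum_j \sum_i rh n j * (zW d i j * zV z i n).
    rewrite exchange_big [RHS]exchange_big /=; apply: eq_bigr => j _.
    under eq_bigr do rewrite mulr_sumr.
    rewrite exchange_big /=; apply: eq_bigr => n _.
    by apply: eq_bigr => i _; ring.
  have -> : \sum_i \sum_n zV d i n * (\sum_j rh n j * zW z i j) =
            \sum_n \sum_j \sum_i rh n j * (zW z i j * zV d i n).
    rewrite exchange_big /=; apply: eq_bigr => n _.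
    under eq_bigr do rewrite mulr_sumr.
    rewrite exchange_big /=; apply: eq_bigr => j _.
    by apply: eq_bigr => i _; ring.
  have -> : \sum_j 2 * zb2 d j 0 * (\sum_n rh n j * 1) =
            \sum_n \sum_j rh n j * (2 * zb2 d j 0).
    under eq_bigr do rewrite mulr_sumr.
    rewrite exchange_big /=; apply: eq_bigr => n _; apply: eq_bigr => j _; ring.
  rewrite -!big_split; apply: eq_bigr => n _ /=.
  rewrite -!big_split; apply: eq_bigr => j _ /=.
  by rewrite /drad mulrDr mulr_sumr -big_split /=; congr (_ + _);
     apply: eq_bigr => i _; rewrite mulrDr.
have B1 : - (2 * c * \sum_i \sum_j zW d i j * (\sum_n rh n j * zV z i n)) <=
  L / 2 * sW d + 2 * c ^+ 2 / L * (sV z * S).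
  have -> : sV z * S = \sum_i \sum_j (\sum_n rh n j ^+ 2) * (\sum_n zV z i n ^+ 2).
    rewrite mulr_suml; apply: eq_bigr => i _; rewrite mulrC /S exchange_big mulr_suml /=.
    by apply: eq_bigr.
  rewrite /sW !mulr_sumr -big_split -sumrN /=; apply: ler_sum => i _.
  rewrite !mulr_sumr -big_split -sumrN /=; apply: ler_sum => j _.
  rewrite mulrA; apply: (le_trans (young L _ _ _ L0)).
  by rewrite lerD2l ler_wpM2l // sum_CauchySchwarz.
have B2 : - (2 * c * \sum_i \sum_n zV d i n * (\sum_j rh n j * zW z i j)) <=
  L / 2 * sV d + 2 * c ^+ 2 / L * (sW z * S).
  have -> : sW z * S = \sum_i \sum_n (\sum_j rh n j ^+ 2) * (\sum_j zW z i j ^+ 2).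
    rewrite mulr_suml; apply: eq_bigr => i _; rewrite mulrC /S mulr_suml /=.
    by apply: eq_bigr.
  rewrite /sV !mulr_sumr -big_split -sumrN /=; apply: ler_sum => i _.
  rewrite !mulr_sumr -big_split -sumrN /=; apply: ler_sum => n _.
  rewrite mulrA; apply: (le_trans (young L _ _ _ L0)).
  by rewrite lerD2l ler_wpM2l // sum_CauchySchwarz.
have B3 : - (2 * c * \sum_j 2 * zb2 d j 0 * (\sum_n rh n j * 1)) <=
  L / 2 * (2 * sb2 d) + 2 * c ^+ 2 / L * (2 * N%:R * S).
  have -> : 2 * N%:R * S = \sum_j 2 * ((\sum_n rh n j ^+ 2) * (\sum_(n < N) 1 ^+ 2)).
    under eq_bigr do rewrite mulrA; rewrite -mulr_suml -mulr_sumr /S exchange_big /=.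
    by rewrite expr1n sumr_const card_ord mulrAC.
  rewrite /sb2 !mulr_sumr -big_split -sumrN /=; apply: ler_sum => j _.
  have := young L c (zb2 d j 0) (\sum_n rh n j * 1) L0.
  have := sum_CauchySchwarz _ (fun n => rh n j) (fun=> 1) => /(ler_wpM2l S0).
  set K := 2 * c ^+ 2 / L; set P := \sum_n rh n j * 1; set A := \sum_n rh n j ^+ 2.
  by set B := \sum_(n < N) 1 ^+ 2 => h1 h2; nra.
lra.
Qed.

End Radial.

(** * One step of the Lyapunov function *)
Section LyapunovStep.
Context {R : realType} {N N0 N1 : nat}.
Context (X : 'M[R]_(N0, N)) (lam1 lam2 beta : R).
Implicit Types (z : zvec R N N0 N1) (m : R).

(** For r >= 0 put y = x sigma~'(r): then |y| <= |x|, rho = r - y, and 3/4 y^2 minus the left-hand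
    side is the square (2 r + y)^2 / 12. For r < 0, [rho] vanishes. *)
Lemma rho_res_bound m z n j : 0 < m ->
  - (rho X m z n j * res z n j) + 2 / 3 * rho X m z n j ^+ 2 <= 3 / 4 * X j n ^+ 2.
Proof.
move=> m0; rewrite /rho; set r := res z n j; set x := X j n.
have s0 := dsigt_ge0 m r m0; have s1 := dsigt_le1 m r m0.
have [r0|r0] := ltP r 0.
  have -> : dsigt m r = 0 by rewrite /dsigt r0.
  by rewrite mulr0 subr0 mul0r expr0n mulr0 oppr0 addr0 mulr_ge0 ?sqr_ge0.
set s := dsigt m r in s0 s1 *; have s2 : s ^+ 2 <= 1 by rewrite expr2 mulr_ile1.
have xs : (x * s) ^+ 2 <= x ^+ 2 by rewrite exprMn ler_piMr ?sqr_ge0.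
set y := x * s in xs *.
have : 0 <= (2 * r + y) ^+ 2 by rewrite sqr_ge0.
nra.
Qed.

(* [2/3] and [3/4] are a pair [c], [1/(4(1-c))] in [- rho r + c rho^2 <= x^2/(4(1-c))]. *)
Lemma lyap_step al zk z m L : (0 < N)%N -> 0 <= beta -> 0 <= al -> 0 < m -> 0 < L ->
  Zset X al z ->
  (forall y, Zset X al y -> spg_sub X lam1 lam2 beta zk m L z
                             <= spg_sub X lam1 lam2 beta zk m L y) ->
  sV zk + sW zk + 2 * N%:R <= 4 / 3 * N%:R * L ->
  L / 2 * (lyap z - lyap zk) <=
    3 * (N%:R^-1 * frob2 X) - lam1 * tV z - 2 * lam2 * sW z.
Proof.
move=> Npos b0 al0 m0 L0 Zz H hL.
have := radial_variation _ _ _ _ _ _ _ _ _ al0 m0 Zz H.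
have := dP_radial_ge0 X beta _ zk _ b0 m0 Zz.1.
have := lyap_polar z zk.
rewrite /dH; set ipz := ip _ _; set p := dP _ _ _ _ _ => Eip p0 hv.
have n0 : 0 < N%:R :> R by rewrite ltr0n.
set c := N%:R^-1 : R; have c0 : 0 < c by rewrite invr_gt0.
have cN : c * N%:R = 1 by rewrite mulVf // gt_eqF.
have EF : dF X m zk (radial z) =
   4 * c * (\sum_n \sum_j rho X m zk n j * res zk n j)
   + 2 * c * (\sum_n \sum_j rho X m zk n j * drad zk (z - zk) n j).
  rewrite /dF -/c !mulr_sumr -big_split; apply: eq_bigr => n _ /=.
  rewrite !mulr_sumr -big_split; apply: eq_bigr => j _ /=.
  by rewrite dres_radial; ring.
have := young_drad (rho X m zk) c L zk (z - zk) L0.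
set S1 := \sum_n \sum_j rho X m zk n j * res zk n j in EF *.
set S2 := \sum_n \sum_j rho X m zk n j * drad _ _ _ _ in EF *.
set S3 := \sum_n \sum_j rho X m zk n j ^+ 2.
have S30 : 0 <= S3 by apply: sumr_ge0 => n _; apply: sumr_ge0 => j _; rewrite sqr_ge0.
have hS : - S1 + 2 / 3 * S3 <= 3 / 4 * frob2 X.
  rewrite /frob2 exchange_big /= !mulr_sumr -sumrN -big_split; apply: ler_sum => n _ /=.
  rewrite !mulr_sumr -sumrN -big_split; apply: ler_sum => j _ /=.
  exact: rho_res_bound.
(* The hypothesis on [L] brings the Young remainder down to 4 c times the 2/3 rho^2 that
   [rho_res_bound] absorbs. *)
have hc : 2 * c ^+ 2 / L * ((sV zk + sW zk + 2 * N%:R) * S3) <= 8 / 3 * c * S3.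
  have -> : 8 / 3 * c * S3 = 2 * c ^+ 2 / L * (4 / 3 * N%:R * L * S3).
    rewrite (_ : 2 * c ^+ 2 / L * (4 / 3 * N%:R * L * S3) = 8 / 3 * c * (c * N%:R) * S3).
      by rewrite cN mulr1.
    by field; rewrite gt_eqF.
  by rewrite ler_wpM2l ?ler_wpM2r // divr_ge0 ?(ltW L0) // mulr_ge0 ?sqr_ge0.
have := sb1_ge0 (z - zk).
move: Eip; rewrite /(lyap (z - zk)) => Eip b1 hy.
have hd : L / 2 * (sW (z - zk) + sV (z - zk) + 2 * sb2 (z - zk)) =
  L * ipz - L / 2 * (lyap z - lyap zk) - L / 2 * sb1 (z - zk).
  have -> : L * ipz = L / 2 * (2 * ipz) by field.
  by rewrite Eip; ring.
have h1 : 0 <= L / 2 * sb1 (z - zk) by rewrite mulr_ge0 //; lra.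
have h2 : c * (- S1 + 2 / 3 * S3) <= c * (3 / 4 * frob2 X) by rewrite ler_wpM2l // ltW.
lra.
Qed.

Lemma sum_sqr_le (I : finType) (a : I -> R) : (forall i, 0 <= a i) ->
  \sum_i a i ^+ 2 <= (\sum_i a i) ^+ 2.
Proof.
move=> a0; rewrite [X in _ <= X]expr2 mulr_suml; apply: ler_sum => i _.
rewrite expr2 ler_wpM2l // (bigD1 i) //= lerDl.
exact: sumr_ge0.
Qed.

Lemma sV_le_tV z : (forall i n, 0 <= zV z i n) -> sV z <= tV z ^+ 2.
Proof.
move=> v0; rewrite /sV exchange_big /=.
apply: (@le_trans _ _ (\sum_n (\sum_i zV z i n) ^+ 2)).
  by apply: ler_sum => n _; apply: sum_sqr_le.
by apply: sum_sqr_le => n; apply: sumr_ge0.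
Qed.

Lemma tV_ge0 z : (forall i n, 0 <= zV z i n) -> 0 <= tV z.
Proof. by move=> v0; apply: sumr_ge0 => n _; apply: sumr_ge0. Qed.

Lemma Omega2_zV_ge0 z : Omega2 X z -> forall i n, 0 <= zV z i n.
Proof. by move=> /Omega2P H i n; apply: le_trans (H n i); exact: pos_ge0. Qed.

(** With w = [sW z] and v = [tV z], the two bounds on theta turn the sublevel condition into 2 w +
    eta v <= 3 eta^2. Hence v <= 3 eta, [sV z] <= v^2 <= 3 eta v, and w + 3 eta v <= 9 eta^2. *)
Lemma sWsV_sublevel theta eta z : 0 < eta -> 0 < theta ->
  theta <= lam2 * eta ^+ 2 -> theta <= lam1 * eta ->
  (forall i n, 0 <= zV z i n) ->
  2 * lam2 * sW z + lam1 * tV z <= 3 * theta -> sW z + sV z <= 9 * eta ^+ 2.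
Proof.
move=> e0 t0 h2 h1 v0 h.
have vt := sV_le_tV _ v0; have v1 := tV_ge0 _ v0; have w0 := sW_ge0 z.
set w := sW z in h w0 *; set v := tV z in h vt v1 *.
have e2 : 0 < eta ^+ 2 by rewrite exprn_gt0.
have k1 : theta * w <= lam2 * eta ^+ 2 * w by rewrite ler_wpM2r.
have k2 : theta * v <= lam1 * eta * v by rewrite ler_wpM2r.
have k3 : (2 * lam2 * w + lam1 * v) * eta ^+ 2 <= 3 * theta * eta ^+ 2.
  by rewrite ler_wpM2r // ltW.
have k4 : eta * (theta * v) <= eta * (lam1 * eta * v) by rewrite ler_wpM2l // ltW.
have k5 : theta * (2 * w + eta * v) <= theta * (3 * eta ^+ 2) by nra.
have k6 : 2 * w + eta * v <= 3 * eta ^+ 2 by rewrite -(ler_pM2l t0).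
have k7 : v <= 3 * eta by rewrite -(ler_pM2l e0); nra.
have : v ^+ 2 <= 3 * eta * v by rewrite expr2 ler_wpM2r.
nra.
Qed.

Lemma lyap_box al z : 0 <= al -> Omega3 al z ->
  lyap z <= sW z + sV z + (N1%:R + 2 * N0%:R) * al ^+ 2.
Proof.
move=> al0 [H1 H2].
have e1 : sb1 z <= N1%:R * al ^+ 2.
  have -> : N1%:R * al ^+ 2 = \sum_(i < N1) al ^+ 2.
    by rewrite sumr_const card_ord mulr_natl.
  by apply: ler_sum => i _; rewrite -real_normK ?num_real // ler_pXn2r ?nnegrE.
have e2 : sb2 z <= N0%:R * al ^+ 2.
  have -> : N0%:R * al ^+ 2 = \sum_(i < N0) al ^+ 2.
    by rewrite sumr_const card_ord mulr_natl.
  by apply: ler_sum => i _; rewrite -real_normK ?num_real // ler_pXn2r ?nnegrE.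
rewrite /lyap; lra.
Qed.

End LyapunovStep.

(** * Two polynomial inequalities *)
Section Numeric.
Context {R : realType}.
Implicit Types (p a : R).

(** Expands the square with 117/64 <= 15/8, (39/32)^2 <= 3/2 and p^2 <= n0 p^2. With n0 p frozen as
    k, the right-hand side is affine in [p]. *)
Lemma numeric_split (n0 : R) p (K := 1 + n0 * p) : 1 <= n0 -> 0 <= p ->
  K * (3 / 4 * K + 39 / 32 * p) ^+ 2 <=
  9 / 16 * K ^+ 3 + p * (15 / 8 * K ^+ 2 + 3 / 2 * (n0 * p) * K).
Proof.
move=> n1 p0; rewrite -subr_ge0.
have K0 : 0 <= K by rewrite /K; nra.
have h1 : 0 <= K * (p ^+ 2 * (n0 - 1)) by rewrite !mulr_ge0 ?sqr_ge0 ?subr_ge0.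
have h2 : 0 <= K * p ^+ 2 by rewrite mulr_ge0 ?sqr_ge0.
have h3 : 0 <= K ^+ 2 * p by rewrite mulr_ge0 ?sqr_ge0.
lra.
Qed.

(** With k = n0 p held fixed, only the endpoints p = 0 and p = k have to be checked. *)
Lemma affine_ge0 (A B p k : R) : 0 <= p <= k -> 0 <= A -> 0 <= A + k * B -> 0 <= A + p * B.
Proof.
move=> /andP[p0 pk] A0 AB; have [B0|B0] := leP 0 B; first by rewrite addr_ge0 ?mulr_ge0.
nra.
Qed.

(* [K (3/4 K + 39/32 p)^2] bounds [K/4] times the square of the value required of [LgH] in
   [scalar_lower], and the right-hand side is what [lower_linear] provides; likewise
   [numeric_small] for [lower_smoothed]. *)
Lemma numeric_large (n0 : R) p (k := n0 * p) (K := 1 + k) : 1 <= n0 -> 0 <= p ->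
  K * (3 / 4 * K + 39 / 32 * p) ^+ 2 <= K ^+ 3 + p * (1 + 2 * k) ^+ 2.
Proof.
move=> n1 p0; apply: (le_trans (numeric_split _ _ n1 p0)); rewrite -/k -/K.
have pk : 0 <= p <= k by rewrite p0 /= /k; nra.
have k0 : 0 <= k by case/andP: pk => ? ?; lra.
rewrite -subr_ge0.
have -> : K ^+ 3 + p * (1 + 2 * k) ^+ 2 - (9 / 16 * K ^+ 3 + p * (15 / 8 * K ^+ 2 + 3 / 2 * k * K))
 = 7 / 16 * K ^+ 3 + p * ((1 + 2 * k) ^+ 2 - 15 / 8 * K ^+ 2 - 3 / 2 * k * K) by field.
apply: (affine_ge0 _ _ _ _ pk).
  by rewrite mulr_ge0 ?exprn_ge0 // /K; lra.
have -> : 7 / 16 * K ^+ 3 + k * ((1 + 2 * k) ^+ 2 - 15 / 8 * K ^+ 2 - 3 / 2 * k * K)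
  = 7 / 16 + 7 / 16 * k + 1 / 16 * k ^+ 2 + 17 / 16 * k ^+ 3 by rewrite /K; field.
by have := exprn_ge0 2 k0; have := exprn_ge0 3 k0; lra.
Qed.

Lemma numeric_small (n0 : R) p a (k := n0 * p) (K := 1 + k) : 1 <= n0 -> 0 <= p -> 0 <= a ->
  K * (3 / 4 * K + 39 / 32 * p) ^+ 2 <=
  (1 - a / 2) ^+ 2 * (K ^+ 3 + p * (1 + 2 * k) ^+ 2) + n0 * K ^+ 2 * (p + a) ^+ 2.
Proof.
move=> n1 p0 a0; apply: (le_trans (numeric_split _ _ n1 p0)); rewrite -/k -/K.
have pk : 0 <= p <= k by rewrite p0 /= /k; nra.
have k0 : 0 <= k by case/andP: pk => ? ?; lra.
have K0 : 0 <= K by rewrite /K; lra.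
(* Here n0 >= 1 is spent on the a^2 term only; the lower bound is again affine in [p] for fixed
   [k]. *)
have h : K ^+ 2 * (k * p + 2 * a * k + a ^+ 2) <= n0 * K ^+ 2 * (p + a) ^+ 2.
  rewrite -subr_ge0.
  have -> : n0 * K ^+ 2 * (p + a) ^+ 2 - K ^+ 2 * (k * p + 2 * a * k + a ^+ 2)
    = K ^+ 2 * (a ^+ 2 * (n0 - 1)) by rewrite /k; ring.
  by rewrite !mulr_ge0 ?sqr_ge0 ?subr_ge0.
rewrite -subr_ge0; set T := n0 * _ * _ in h *.
suff : 0 <= (1 - a / 2) ^+ 2 * (K ^+ 3 + p * (1 + 2 * k) ^+ 2)
   + K ^+ 2 * (k * p + 2 * a * k + a ^+ 2)
   - (9 / 16 * K ^+ 3 + p * (15 / 8 * K ^+ 2 + 3 / 2 * k * K)) by lra.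
set E := (X in 0 <= X).
have -> : E = ((1 - a / 2) ^+ 2 * K ^+ 3 + K ^+ 2 * (2 * a * k + a ^+ 2) - 9 / 16 * K ^+ 3)
  + p * ((1 - a / 2) ^+ 2 * (1 + 2 * k) ^+ 2 + K ^+ 2 * k
      - 15 / 8 * K ^+ 2 - 3 / 2 * k * K) by rewrite /E; field.
apply: (affine_ge0 _ _ _ _ pk).
  have -> : (1 - a / 2) ^+ 2 * K ^+ 3 + K ^+ 2 * (2 * a * k + a ^+ 2) - 9 / 16 * K ^+ 3
    = K ^+ 2 * (7 / 16 - a + 5 / 4 * a ^+ 2 + k * (7 / 16 + a + a ^+ 2 / 4)) by rewrite /K; field.
  rewrite mulr_ge0 ?sqr_ge0 // addr_ge0 //; first by nra.
  by rewrite mulr_ge0 //; nra.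
set F := (X in 0 <= X).
(* At the endpoint p = k the expression is a quadratic in [a] with positive leading coefficient; [D]
   says that its discriminant is not positive. *)
pose A2 := 5 / 4 + 3 * k + 11 / 4 * k ^+ 2 + 5 / 4 * k ^+ 3.
pose B2 := 1 + 2 * k + 3 * k ^+ 2 + 3 * k ^+ 3.
pose C2 := 7 / 16 + 7 / 16 * k + 17 / 16 * k ^+ 2 + 49 / 16 * k ^+ 3 + k ^+ 4.
have EF : F = A2 * a ^+ 2 - B2 * a + C2 by rewrite /F /A2 /B2 /C2 /K; field.
have A0 : 0 < A2 by rewrite /A2; have := exprn_ge0 2 k0; have := exprn_ge0 3 k0; lra.
have D : 0 <= 4 * A2 * C2 - B2 ^+ 2.
  rewrite /A2 /B2 /C2.
  have := exprn_ge0 2 k0; have := exprn_ge0 3 k0; have := exprn_ge0 4 k0.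
  have := exprn_ge0 5 k0; have := exprn_ge0 6 k0; have := exprn_ge0 7 k0.
  lra.
rewrite -(pmulr_rge0 _ A0) EF -(pmulr_rge0 _ (ltr0n _ 4)).
have -> : 4 * (A2 * (A2 * a ^+ 2 - B2 * a + C2)) = (2 * A2 * a - B2) ^+ 2 + (4 * A2 * C2 - B2 ^+ 2) by ring.
by rewrite addr_ge0 ?sqr_ge0.
Qed.
End Numeric.

(** * Lower bound for the Lipschitz constant of the gradient *)
Section ScalarLower.
Context {R : realType}.

Lemma near0_lt (c d : R) : 0 < d -> \forall t \near 0^'+, t * c < d.
Proof.
move=> d0; have e0 : 0 < d / (`|c| + 1) by rewrite divr_gt0 // ltr_wpDl.
near=> t; have t0 : 0 < t by near: t; exact: nbhs_right_gt.
have te : t < d / (`|c| + 1) by near: t; exact: nbhs_right_lt.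
move: te; rewrite ltr_pdivlMr ?ltr_wpDl // => te.
have := ler_norm c; nra.
Unshelve. all: by end_near. Qed.

Lemma near0_affine_le (D E C : R) : (\forall t \near 0^'+, D - t * E <= C) -> D <= C.
Proof.
move=> H; rewrite leNgt; apply/negP => DC.
have : \forall t \near (0 : R)^'+, False.
  near=> t; have h : D - t * E <= C by near: t.
  have : t * E < D - C by near: t; apply: near0_lt; lra.
  lra.
by move=> /filter_ex [].
Unshelve. all: by end_near. Qed.

Lemma le_of_scaled (nt q Z1 Z2 T c C : R) : 0 < nt -> q <= Z2 -> 0 <= T -> 0 <= c ->
  nt * (2 * Z2 - Z1 + T) + c <= nt * C -> 2 * q - Z1 <= C.
Proof.
move=> nt0 h1 h2 h3 h; rewrite -(ler_pM2l nt0); apply: le_trans h.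
by rewrite ler_wpDr // ler_pM2l //; lra.
Qed.

(* [m * <grad H~(y, m), e>] at the point [y] with [W = w], [V = v], [b2 = b] (all entries),
   [b1 = 0], where [xb] is the mean of the entries of [X], for the direction [e] with [V]-entries [a n0 / n] and [b2]-entries [1]. This
   direction has no [W]- or [b1]-component, so the concave penalty enters only as [m * c1]. *)
Definition uniform_grad (n n0 n1 a xb c1 w v b m : R) : R :=
  m * (c1 + 2 * n0 * (1 + n1 * n0 * a * w / n)
            * (pp (n1 * w * v + b) - xb * dsigt m (n1 * w * v + b))).

(** The Lipschitz condition paired with [e] by Cauchy-Schwarz: n0 K stands for |e|^2, and the
    weights n1 n0, n n1, n0 count the entries of W, V, b2. *)
Definition uniform_lipschitz (n n0 n1 a xb c1 LgH K : R) : Prop :=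
  forall w v b m w' v' b' m' : R,
  `|w| <= a -> `|v| <= a -> `|b| <= a -> 0 < m < 1 ->
  `|w'| <= a -> `|v'| <= a -> `|b'| <= a -> 0 < m' < 1 ->
  uniform_grad n n0 n1 a xb c1 w v b m - uniform_grad n n0 n1 a xb c1 w' v' b' m' <=
  LgH * (Num.sqrt (n0 * K) * Num.sqrt (n1 * n0 * (w - w') ^+ 2 + n * n1 * (v - v') ^+ 2
     + n0 * (b - b') ^+ 2 + (m - m') ^+ 2)).

Lemma uniform_consts (n n0 n1 a : R) (p := n1 * a ^+ 2 / n) (k := n0 * p) (K := 1 + k)
    (w2 := n1 * a ^+ 2) (Q := K ^+ 3 + w2 * (1 + 2 * k) ^+ 2) :
  1 <= n -> 1 <= n0 -> 1 <= n1 -> 0 < a ->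
  [/\ 0 < n, 0 < n0 & 0 < n1] /\ [/\ 0 <= p, 0 <= k, 0 < w2, p <= w2 & 0 < Q].
Proof.
move=> hn hn0 hn1 ha.
have n_p : 0 < n by exact: lt_le_trans ltr01 hn.
have n0_p : 0 < n0 by exact: lt_le_trans ltr01 hn0.
have n1_p : 0 < n1 by exact: lt_le_trans ltr01 hn1.
have w2_p : 0 < w2 by rewrite mulr_gt0 ?exprn_gt0.
have p0 : 0 <= p by apply: divr_ge0; exact: ltW.
have k0 : 0 <= k by apply: mulr_ge0 => //; exact: ltW.
do 2!split=> //; first by rewrite /p ler_pdivrMr // -/w2 ler_peMr // ltW.
apply: ltr_wpDr; first by rewrite mulr_ge0 ?sqr_ge0 // ltW.
by rewrite exprn_gt0 // /K ltr_wpDr.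
Qed.

Lemma sqrt_cancel (LgH K S : R) : 0 < K -> 0 < S -> 2 * S <= LgH * (Num.sqrt K * Num.sqrt S) ->
  0 < LgH /\ 4 * S <= LgH ^+ 2 * K.
Proof.
move=> K0 S0 h.
have sK : 0 < Num.sqrt K by rewrite sqrtr_gt0.
have sS : 0 < Num.sqrt S by rewrite sqrtr_gt0.
have L0 : 0 < LgH.
  have : 0 < LgH * (Num.sqrt K * Num.sqrt S) by lra.
  by rewrite pmulr_lgt0 // mulr_gt0.
split=> //.
have eS : Num.sqrt S ^+ 2 = S by rewrite sqr_sqrtr // ltW.
have eK : Num.sqrt K ^+ 2 = K by rewrite sqr_sqrtr // ltW.
have h1 : 2 * Num.sqrt S <= LgH * Num.sqrt K.
  by rewrite -(ler_pM2r sS) -mulrA -expr2 eS -mulrA.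
rewrite -{1}eS -eK -exprMn; have -> : 4 * Num.sqrt S ^+ 2 = (2 * Num.sqrt S) ^+ 2 by ring.
by rewrite ler_pXn2r // nnegrE mulr_ge0 // ltW.
Qed.

(* Derivative at the corner [w = v = b = a], along the metric gradient, when the
   smoothing of the ReLU is inactive there. *)
Lemma lower_linear (n n0 n1 a xb c1 LgH : R) (p := n1 * a ^+ 2 / n) (k := n0 * p)
    (K := 1 + k) (w2 := n1 * a ^+ 2) (r0 := w2 + a) (Q := K ^+ 3 + w2 * (1 + 2 * k) ^+ 2) :
  1 <= n -> 1 <= n0 -> 1 <= n1 -> 0 < a -> 0 <= c1 -> `|xb| <= a / 2 ->
  uniform_lipschitz n n0 n1 a xb c1 LgH K ->
  1 <= r0 -> 2 * Q <= LgH * (Num.sqrt K * Num.sqrt Q).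
Proof.
move=> hn hn0 hn1 ha hc hx hLip hr.
have [[n_p n0_p n1_p] [p_p kp w2_p pw Q_p]] := uniform_consts _ _ _ _ hn hn0 hn1 ha.
rewrite -/p -/w2 -/k -/K -/Q in p_p kp w2_p pw Q_p.
have K0 : 0 < K by rewrite /K ltr_wpDr.
have KE : K = 1 + k by [].
(* Partial derivatives of (1 + n1 n0 a w / n)(n1 w v + b - xb) at the corner, divided by the weights
   of the metric and multiplied by n0, with r0 - xb replaced by its part [w2]. The omitted a - xb is
   positive and only raises the derivative. *)
pose dw := a * (1 + 2 * k); pose dv := n0 * a * K / n; pose db := K.
pose al := n1 * n0 * a * dw / n; pose be := n1 * a * (dw + dv) + db.
pose ga := n1 * dw * dv.
have dw0 : 0 <= dw by apply: mulr_ge0; lra.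
have dv0 : 0 <= dv by rewrite divr_ge0 ?mulr_ge0 // ltW.
have al0 : 0 <= al.
  by apply: divr_ge0; [apply: mulr_ge0 => //; rewrite ltW // !mulr_gt0|exact: ltW].
have ga0 : 0 <= ga by apply: mulr_ge0 => //; apply: mulr_ge0 => //; exact: ltW.
have be0 : 0 <= be.
  apply: addr_ge0; last exact: ltW.
  by apply: mulr_ge0; [apply: mulr_ge0; exact: ltW|exact: addr_ge0].
have xb1 : xb <= a / 2 by rewrite (le_trans (ler_norm _)).
have hD : Q <= al * (r0 - xb) + K * be.
  have -> : Q = al * w2 + K * be.
    rewrite /Q /al /be /db /dw /dv /w2 KE /k /p; field; lra.
  by rewrite lerD2r ler_wpM2l // /r0; lra.
set C := LgH * _.
suff Hm : \forall s \near 0^'+, 2 * Q - s * (2 * Q) <= C.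
  exact: near0_affine_le Hm.
(* The range of the smoothing parameter is open, so 1 is approached by m = 1 - s: t tends to 0 for
   fixed s, and s afterwards. *)
near=> s; set m := 1 - s.
have s0 : 0 < s by near: s; exact: nbhs_right_gt.
have s1 : s < 1 by near: s; exact: nbhs_right_lt.
have m01 : 0 < m < 1 by move: s0 s1; clear; rewrite /m => *; lra.
have /andP[m_gt0 m_lt1] := m01.
have -> : 2 * Q - s * (2 * Q) = 2 * m * Q by rewrite /m; ring.
suff Ht : \forall t \near 0^'+, 2 * m * Q - t * (2 * m * (al * be + K * ga)) <= C.
  exact: near0_affine_le Ht.
near=> t; have t0 : 0 < t by near: t; exact: nbhs_right_gt.
have tw : t * dw < a by near: t; exact: near0_lt.
have tv : t * dv < a by near: t; exact: near0_lt.
have tb : t * db < a by near: t; exact: near0_lt.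
have tr : t * be < r0 - m by near: t; apply: near0_lt; move: hr s0; clear; rewrite /m => *; lra.
have tw0 : 0 <= t * dw by rewrite mulr_ge0 // ltW.
have tv0 : 0 <= t * dv by rewrite mulr_ge0 // ltW.
have tb0 : 0 <= t * db by rewrite mulr_ge0 // /db ltW.
have bx c : 0 <= c -> c < a -> `|a - c| <= a.
  by move=> *; rewrite ger0_norm ?subr_ge0 ?gerBl // ltW.
have aa : `|a| <= a by rewrite ger0_norm // ltW.
have := hLip a a a m (a - t * dw) (a - t * dv) (a - t * db) m aa aa aa m01
  (bx _ tw0 tw) (bx _ tv0 tv) (bx _ tb0 tb) m01.
have E1 : n1 * a * a + a = r0 by rewrite /r0 /w2; ring.
have E2 : n1 * (a - t * dw) * (a - t * dv) + (a - t * db) = r0 - t * be + t ^+ 2 * ga.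
  by rewrite /r0 /w2 /be /ga; ring.
have sat r : m <= r -> pp r - xb * dsigt m r = r - xb.
  move=> mr; rewrite max_l; last exact: le_trans (ltW m_gt0) mr.
  rewrite /dsigt ltNge (le_trans _ mr) /=; last exact: ltW.
  case: (leP r m) => rm; last by rewrite mulr1.
  have -> : r = m by apply/eqP; rewrite eq_le rm mr.
  by rewrite divff ?mulr1 // gt_eqF.
have t2 : 0 <= t ^+ 2 * ga by rewrite mulr_ge0 ?sqr_ge0.
have rm : m <= r0 - t * be + t ^+ 2 * ga by rewrite ler_wpDr // lerBrDr -lerBrDl ltW.
rewrite /uniform_grad E1 E2 !sat //; last exact: le_trans (ltW m_lt1) hr.
have -> : n1 * n0 * (a - (a - t * dw)) ^+ 2 + n * n1 * (a - (a - t * dv)) ^+ 2 +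
   n0 * (a - (a - t * db)) ^+ 2 + (m - m) ^+ 2 = t ^+ 2 * (n0 * Q).
  by rewrite /Q /dw /dv /db /w2 KE /k /p; field; lra.
have n00 : 0 <= n0 by exact: ltW.
rewrite [Num.sqrt (t ^+ 2 * _)]sqrtrM ?sqr_ge0 // sqrtr_sqr (ger0_norm (ltW t0)) !sqrtrM //.
have en : Num.sqrt n0 * Num.sqrt n0 = n0 by rewrite -expr2 sqr_sqrtr.
have -> : LgH * (Num.sqrt n0 * Num.sqrt K * (t * (Num.sqrt n0 * Num.sqrt Q))) = n0 * t * C.
  by rewrite /C -{3}en; ring.
have -> : 1 + n1 * n0 * a * a / n = K by rewrite /K /k /p; ring.
have -> : 1 + n1 * n0 * a * (a - t * dw) / n = K - t * al by rewrite /K /k /p /al; ring.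
set A := (X in X <= _).
have -> : A = n0 * t * (2 * (m * (al * (r0 - xb) + K * be))
   - t * (2 * m * (al * be + K * ga)) + t ^+ 2 * (2 * m * (al * ga))) + 0.
  by rewrite /A; ring.
have m0 : 0 <= 2 * m by exact: mulr_ge0 (ltW m_gt0).
have h1 : m * Q <= m * (al * (r0 - xb) + K * be) by rewrite ler_wpM2l // ltW.
have h2 : 0 <= t ^+ 2 * (2 * m * (al * ga)).
  by apply: mulr_ge0; [exact: sqr_ge0|apply: mulr_ge0 => //; exact: mulr_ge0].
rewrite -[2 * m * Q]mulrA; apply: le_of_scaled h1 h2 (lexx 0); exact: mulr_gt0.
Unshelve. all: by end_near. Qed.

(* When the smoothing is active at the corner, the variation of [m] is used as well. *)
Lemma lower_smoothed (n n0 n1 a xb c1 LgH : R) (p := n1 * a ^+ 2 / n) (k := n0 * p)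
    (K := 1 + k) (w2 := n1 * a ^+ 2) (r0 := w2 + a) (Q := K ^+ 3 + w2 * (1 + 2 * k) ^+ 2)
    (sg := 1 - xb) (Qs := sg ^+ 2 * Q + n0 * K ^+ 2 * r0 ^+ 2) :
  1 <= n -> 1 <= n0 -> 1 <= n1 -> 0 < a -> 0 <= c1 -> `|xb| <= a / 2 ->
  uniform_lipschitz n n0 n1 a xb c1 LgH K ->
  r0 < 1 -> 2 * Qs <= LgH * (Num.sqrt K * Num.sqrt Qs).
Proof.
move=> hn hn0 hn1 ha hc hx hLip hr.
have [[n_p n0_p n1_p] [p_p kp w2_p pw Q_p]] := uniform_consts _ _ _ _ hn hn0 hn1 ha.
rewrite -/p -/w2 -/k -/K -/Q in p_p kp w2_p pw Q_p.
have K0 : 0 < K by rewrite /K ltr_wpDr.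
have KE : K = 1 + k by [].
have r0_p : 0 < r0 by apply: addr_gt0.
have a1 : a < 1 by rewrite /r0 in hr; lra.
have xb1 : xb <= a / 2 by rewrite (le_trans (ler_norm _)).
have sg0 : 0 < sg by rewrite /sg; lra.
(* The directions of the linear case times m - xb at m = 1, which is [sg]. The residual term is now
   r (m - xb), whose m-derivative contributes K r0, scaled by n0 in [dm]. *)
pose dw := sg * (a * (1 + 2 * k)); pose dv := sg * (n0 * a * K / n); pose db := sg * K.
pose dm := n0 * K * r0.
pose al := n1 * n0 * a * dw / n; pose be := n1 * a * (dw + dv) + db.
pose ga := n1 * dw * dv.
have dw0 : 0 <= dw by apply: mulr_ge0; [exact: ltW|apply: mulr_ge0; lra].
have dv0 : 0 <= dv.
  by apply: mulr_ge0; [exact: ltW|rewrite divr_ge0 ?mulr_ge0 // ltW].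
have db0 : 0 < db by apply: mulr_gt0.
have dm0 : 0 <= dm by apply: mulr_ge0; [apply: mulr_ge0; exact: ltW|exact: ltW].
have al0 : 0 <= al.
  by apply: divr_ge0; [apply: mulr_ge0 => //; rewrite ltW // !mulr_gt0|exact: ltW].
have ga0 : 0 <= ga by apply: mulr_ge0 => //; apply: mulr_ge0 => //; exact: ltW.
have be0 : 0 <= be.
  apply: addr_ge0; last exact: ltW.
  by apply: mulr_ge0; [apply: mulr_ge0; exact: ltW|exact: addr_ge0].
pose D1 := al * r0 + K * be; pose E1' := al * be + K * ga.
have D10 : 0 <= D1 by apply: addr_ge0; apply: mulr_ge0 => //; exact: ltW.
have hD : sg * Q <= D1.
  have -> : sg * Q = al * w2 + K * be.
    rewrite /Q /al /be /db /dw /dv /w2 KE /k /p; field; lra.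
  by rewrite lerD2r ler_wpM2l // /r0; lra.
set C := LgH * _.
suff Hm : \forall s \near 0^'+, 2 * Qs - s * (2 * D1) <= C.
  exact: near0_affine_le Hm.
near=> s; set m := 1 - s.
have s0 : 0 < s by near: s; exact: nbhs_right_gt.
have s1 : s * 2 < 1 by near: s; exact: near0_lt.
have s2 : s * 1 < 1 - r0 by near: s; apply: near0_lt; rewrite subr_gt0.
have m01 : 0 < m < 1 by move: s0 s1; clear; rewrite /m => *; lra.
have /andP[m_gt0 m_lt1] := m01.
have r0m : 0 <= r0 <= m.
  by rewrite (ltW r0_p) /=; move: s2; clear; rewrite /m => *; lra.
pose M := m - xb.
have M0 : 0 <= M by move: s1 xb1 a1; clear; rewrite /M /m => *; lra.
suff Ht : \forall t \near 0^'+, 2 * Qs - s * (2 * D1)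
    - t * (2 * (E1' * M + dm * (D1 + al * ga))) <= C.
  exact: near0_affine_le Ht.
near=> t; have t0 : 0 < t by near: t; exact: nbhs_right_gt.
have t1 : t < 1 by near: t; exact: nbhs_right_lt.
have tw : t * dw < a by near: t; exact: near0_lt.
have tv : t * dv < a by near: t; exact: near0_lt.
have tb : t * db < a by near: t; exact: near0_lt.
have tr : t * (ga + dm) < m - r0 by near: t; apply: near0_lt; move: s2; clear; rewrite /m => *; lra.
have tw0 : 0 <= t * dw by rewrite mulr_ge0 // ltW.
have tv0 : 0 <= t * dv by rewrite mulr_ge0 // ltW.
have tb0 : 0 <= t * db by apply: mulr_ge0; exact: ltW.
have tm0 : 0 <= t * dm by rewrite mulr_ge0 // ltW.
have tg0 : 0 <= t * ga by rewrite mulr_ge0 // ltW.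
have tbe0 : 0 <= t * be by rewrite mulr_ge0 // ltW.
have bx c : 0 <= c -> c < a -> `|a - c| <= a.
  by move=> *; rewrite ger0_norm ?subr_ge0 ?gerBl // ltW.
have aa : `|a| <= a by rewrite ger0_norm // ltW.
have E1 : n1 * a * a + a = r0 by rewrite /r0 /w2; ring.
have E2 : n1 * (a - t * dw) * (a - t * dv) + (a - t * db) = r0 - t * be + t ^+ 2 * ga.
  by rewrite /r0 /w2 /be /ga; ring.
have t2 : 0 <= t ^+ 2 * ga <= t * ga.
  apply/andP; split; first by rewrite mulr_ge0 ?sqr_ge0.
  by rewrite ler_wpM2r // expr2 ler_piMr ?ltW.
have /andP[t2a t2b] := t2.
have rt0 : 0 < r0 - t * be + t ^+ 2 * ga.
  rewrite -E2; apply: ltr_wpDl; last by rewrite subr_gt0.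
  by rewrite mulr_ge0 ?mulr_ge0 ?subr_ge0 // ltW.
have rtm : r0 - t * be + t ^+ 2 * ga <= m - t * dm.
  by move: tr t2b tbe0; clear; move: (t ^+ 2) => *; lra.
have m01' : 0 < m - t * dm < 1.
  by rewrite (lt_le_trans rt0 rtm) /= ltrBlDr ltr_wpDr.
have := hLip a a a m (a - t * dw) (a - t * dv) (a - t * db) (m - t * dm) aa aa aa m01
  (bx _ tw0 tw) (bx _ tv0 tv) (bx _ tb0 tb) m01'.
(* Below the threshold the slope is r / m', so the prefactor m' cancels. *)
have sat r m' : 0 < m' -> 0 <= r <= m' ->
    m' * (pp r - xb * dsigt m' r) = r * (m' - xb).
  move=> m'0 /andP[r0' rm]; rewrite max_l // /dsigt ltNge r0' /= rm.
  by field; rewrite gt_eqF.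
have ug w v b m' : 0 < m' -> 0 <= n1 * w * v + b <= m' ->
    uniform_grad n n0 n1 a xb c1 w v b m' =
    m' * c1 + 2 * n0 * (1 + n1 * n0 * a * w / n) * ((n1 * w * v + b) * (m' - xb)).
  by move=> h1 h2; rewrite /uniform_grad -(sat _ _ h1 h2); ring.
have rtm' : 0 <= r0 - t * be + t ^+ 2 * ga <= m - t * dm by rewrite (ltW rt0).
have /andP[mt0 _] := m01'.
rewrite !ug ?E1 ?E2 //.
have -> : n1 * n0 * (a - (a - t * dw)) ^+ 2 + n * n1 * (a - (a - t * dv)) ^+ 2 +
   n0 * (a - (a - t * db)) ^+ 2 + (m - (m - t * dm)) ^+ 2 = t ^+ 2 * (n0 * Qs).
  by rewrite /Qs /Q /dw /dv /db /dm /r0 /w2 KE /k /p; field; lra.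
have n00 : 0 <= n0 by exact: ltW.
rewrite [Num.sqrt (t ^+ 2 * _)]sqrtrM ?sqr_ge0 // sqrtr_sqr (ger0_norm (ltW t0)) !sqrtrM //.
have en : Num.sqrt n0 * Num.sqrt n0 = n0 by rewrite -expr2 sqr_sqrtr.
have -> : LgH * (Num.sqrt n0 * Num.sqrt K * (t * (Num.sqrt n0 * Num.sqrt Qs))) = n0 * t * C.
  by rewrite /C -{3}en; ring.
have -> : 1 + n1 * n0 * a * a / n = K by rewrite /K /k /p; ring.
have -> : 1 + n1 * n0 * a * (a - t * dw) / n = K - t * al by rewrite /K /k /p /al; ring.
set A := (X in X <= _).
have -> : A = n0 * t * (2 * (D1 * M + dm * (K * r0)) - t * (2 * (E1' * M + dm * (D1 + al * ga)))
  + (t ^+ 2 * (2 * (al * ga * M)) + 2 * t * dm * (t * E1')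
     + 2 * t * (dm * (al * ga)) * (1 - t ^+ 2))) + t * dm * c1.
  by rewrite /A /M /D1 /E1'; ring.
have alga : 0 <= al * ga by exact: mulr_ge0.
have E10 : 0 <= E1' by apply: addr_ge0; apply: mulr_ge0 => //; exact: ltW.
set rest := _ + 2 * t * (dm * _) * _.
have rest0 : 0 <= rest.
  have tt : 0 <= 2 * t by rewrite mulr_ge0 // ltW.
  have t2' : 0 <= 1 - t ^+ 2 by rewrite subr_ge0 expr_le1 // ltW.
  apply: addr_ge0; first apply: addr_ge0.
  - by apply: mulr_ge0; rewrite ?sqr_ge0 // mulr_ge0 // mulr_ge0.
  - apply: mulr_ge0; first exact: mulr_ge0.
    by apply: mulr_ge0 => //; exact: ltW.
  - apply: mulr_ge0 => //; apply: mulr_ge0 => //; exact: mulr_ge0.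
have c10 : 0 <= t * dm * c1 by exact: mulr_ge0.
have nt : 0 < n0 * t by exact: mulr_gt0.
have hQ : Qs - s * D1 <= D1 * M + dm * (K * r0).
  have -> : D1 * M + dm * (K * r0) = D1 * sg - s * D1 + n0 * K ^+ 2 * r0 ^+ 2.
    by rewrite /M /dm /sg /m; ring.
  have h0 := ler_wpM2l (ltW sg0) hD.
  rewrite /Qs expr2 -mulrA [D1 * sg]mulrC; move: h0; clear; move: (sg * (sg * Q)) (sg * D1) (s * D1) (n0 * _ * _) => *; lra.
have -> : 2 * Qs - s * (2 * D1) = 2 * (Qs - s * D1) by ring.
exact: le_of_scaled nt hQ rest0 c10.
Unshelve. all: by end_near. Qed.

(** The cases differ in whether the residual [r0] at the corner exceeds every admissible m. [S] is
    the squared metric length of the test direction divided by n0. *)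
Lemma scalar_lower (n n0 n1 a xb c1 LgH : R) :
  1 <= n -> 1 <= n0 -> 1 <= n1 -> 0 < a -> 0 <= c1 -> `|xb| <= a / 2 ->
  uniform_lipschitz n n0 n1 a xb c1 LgH (1 + n0 * (n1 * a ^+ 2 / n)) ->
  3 / 4 * ((9 / 4 + n1 + 2 * n0) * a ^+ 2 / n + 2) <= LgH.
Proof.
move=> hn hn0 hn1 ha hc hx hLip.
pose p := n1 * a ^+ 2 / n; pose k := n0 * p; pose K := 1 + k; pose w2 := n1 * a ^+ 2.
pose r0 := w2 + a; pose Q := K ^+ 3 + w2 * (1 + 2 * k) ^+ 2.
have [[n_p n0_p n1_p] [p_p kp w2_p pw Q_p]] := uniform_consts _ _ _ _ hn hn0 hn1 ha.
rewrite -/p -/w2 -/k -/K -/Q in p_p kp w2_p pw Q_p.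
have K0 : 0 < K by rewrite /K ltr_wpDr.
have KE : K = 1 + k by [].
set req := (X in X <= _).
(* As n1 >= 1, a^2 / n is at most p; the coefficient 2 (39/32) is 3/4 (9/4 + 1). *)
have req_le : req <= 2 * (3 / 4 * K + 39 / 32 * p).
  have -> : 2 * (3 / 4 * K + 39 / 32 * p) =
    3 / 4 * ((9 / 4 + n1 + 2 * n0) * a ^+ 2 / n + 2)
    + 3 / 4 * (a ^+ 2 / n * (9 / 4 * (n1 - 1) + 2 * n0 * (n1 - 1))).
    by rewrite KE /k /p; field; lra.
  rewrite lerDl; apply: mulr_ge0; first by lra.
  apply: mulr_ge0; first by rewrite divr_ge0 ?sqr_ge0 // ltW.
  by nra.
have req0 : 0 <= req.
  apply: mulr_ge0; first by lra.
  apply: addr_ge0; last by lra.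
  by apply: divr_ge0; [apply: mulr_ge0; [lra|exact: sqr_ge0]|exact: ltW].
suff [S [S0 [hS hL]]] : exists S, 0 < S /\ K * (3 / 4 * K + 39 / 32 * p) ^+ 2 <= S /\
    2 * S <= LgH * (Num.sqrt K * Num.sqrt S).
  have [L0 hL2] := sqrt_cancel _ _ _ K0 S0 hL.
  rewrite -ler_sqr ?nnegrE ?(ltW L0) // -(ler_pM2r K0); apply: le_trans hL2.
  have : req ^+ 2 <= (2 * (3 / 4 * K + 39 / 32 * p)) ^+ 2.
    by rewrite ler_sqr ?nnegrE // (le_trans req0).
  move=> /(ler_wpM2r (ltW K0)); lra.
have pQ : p * (1 + 2 * k) ^+ 2 <= w2 * (1 + 2 * k) ^+ 2.
  by rewrite ler_wpM2r ?sqr_ge0.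
have [hr|hr] := leP 1 r0.
  exists Q; split=> //; split; last exact: lower_linear hc hx hLip hr.
  have := numeric_large n0 p hn0 p_p; rewrite -/k -/K /Q; lra.
have a1 : a < 1 by rewrite /r0 in hr; lra.
have xb1 : xb <= a / 2 by rewrite (le_trans (ler_norm _)).
pose sg := 1 - xb; pose Qs := sg ^+ 2 * Q + n0 * K ^+ 2 * r0 ^+ 2.
have sg1 : 0 < 1 - a / 2 <= sg by rewrite /sg; apply/andP; split; lra.
have /andP[sg2 sg3] := sg1.
exists Qs; split; last split; last exact: lower_smoothed hc hx hLip hr.
  rewrite /Qs; apply: ltr_wpDr.
    by apply: mulr_ge0; [apply: mulr_ge0; [exact: ltW|exact: sqr_ge0]|exact: sqr_ge0].
  by apply: mulr_gt0 => //; apply: exprn_gt0; lra.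
apply: (le_trans (numeric_small n0 p a hn0 p_p (ltW ha))); rewrite -/k -/K /Qs.
apply: lerD.
  apply: ler_pM; [exact: sqr_ge0| |by rewrite ler_sqr ?nnegrE; lra|by rewrite /Q; lra].
  by apply: addr_ge0; [apply: exprn_ge0; exact: ltW|apply: mulr_ge0 => //; exact: sqr_ge0].
apply: ler_wpM2l; first by rewrite mulr_ge0 ?sqr_ge0 // ltW.
by rewrite ler_sqr ?nnegrE /r0; lra.
Qed.

End ScalarLower.

(** * Reduction of the gradient bound to points with constant blocks *)

Section GradientLipschitzLower.
Context {R : realType}.

Lemma ip_le_sqrt (k : nat) (u v : 'rV[R]_k) : ip u v <= Num.sqrt (rsqn u) * Num.sqrt (rsqn v).
Proof.
have u0 : 0 <= rsqn u by apply: sumr_ge0 => j _; exact: sqr_ge0.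
rewrite -sqrtrM // (le_trans (ler_norm _)) // -sqrtr_sqr ler_wsqrtr //.
exact: sum_CauchySchwarz.
Qed.

Lemma ip_scaleB (k : nat) (c c' : R) (u u' v : 'rV[R]_k) :
  ip (c *: u - c' *: u') v = c * ip u v - c' * ip u' v.
Proof. by rewrite /ip !mulr_sumr -sumrB; apply: eq_bigr => j _; rewrite !mxE; ring. Qed.

Lemma sum_const2 (m n : nat) (c : R) : \sum_(i < m) \sum_(j < n) c = m%:R * n%:R * c.
Proof. by rewrite !sumr_const !card_ord -mulrnA -[LHS]mulr_natr natrM; ring. Qed.

Context {N N0 N1 : nat}.
Context (X : 'M[R]_(N0, N)) (beta : R).

Definition unif (w v b : R) : zvec R N N0 N1 :=
  mkz (const_mx w) 0 (const_mx b) (const_mx v).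

Lemma dH_unif m w v b eb ev (r := N1%:R * w * v + b)
    (S := \sum_n \sum_j X j n) : 
  dH X beta m (unif w v b) (mkz 0 0 (const_mx eb) (const_mx ev)) =
  2 / N%:R * ((N1%:R * w * ev + eb) * (N%:R * N0%:R * pp r - S * dsigt m r))
  + beta * (N%:R * N1%:R * ev).
Proof.
rewrite /dH /dF /dP; congr (_ * _ + _ * _); last first.
  rewrite -sum_const2; apply: eq_bigr => n _; apply: eq_bigr => i _.
  rewrite zV_mkz mxE (_ : pre X (mkz 0 0 _ _) n i = 0) ?mulr0 ?subr0 //.
  rewrite /pre zW_mkz zb1_mkz mxE addr0 big1 // => j _.
  by rewrite mxE mul0r.
have rE n j : res (unif w v b) n j = r.
  rewrite /res zb2_mkz mxE; congr (_ + _).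
  under eq_bigr do rewrite zW_mkz zV_mkz !mxE.
  by rewrite sumr_const card_ord -[LHS]mulr_natl mulrA.
have dE n j : dres (unif w v b) (mkz 0 0 (const_mx eb) (const_mx ev)) n j = N1%:R * w * ev + eb.
  rewrite /dres zb2_mkz mxE; congr (_ + _).
  under eq_bigr do rewrite !zW_mkz !zV_mkz !mxE mul0r add0r.
  by rewrite sumr_const card_ord -[LHS]mulr_natl mulrA.
rewrite -sum_const2 /S mulr_suml -sumrB mulr_sumr; apply: eq_bigr => n _.
rewrite mulr_suml -sumrB mulr_sumr; apply: eq_bigr => j _.
by rewrite dE /rho rE mulrC.
Qed.

Lemma rsqn_test ev :
  rsqn (mkz 0 0 (const_mx 1) (const_mx ev) : zvec R N N0 N1) = N0%:R + N1%:R * N%:R * ev ^+ 2.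
Proof.
rewrite rsqn_ip ipE zW_mkz zb1_mkz zb2_mkz zV_mkz -!sum_const2.
rewrite big1 ?add0r => [|i _]; last by rewrite big1 // => j _; rewrite mxE mul0r.
rewrite big1 ?add0r => [|i _]; last by rewrite mxE mul0r.
congr (_ + _); first by under eq_bigr do rewrite !mxE mulr1; rewrite sumr_const card_ord.
by apply: eq_bigr => i _; apply: eq_bigr => j _; rewrite !mxE.
Qed.

Lemma rsqn_unifB w v b w' v' b' : rsqn (unif w v b - unif w' v' b') =
  N1%:R * N0%:R * (w - w') ^+ 2 + N%:R * N1%:R * (v - v') ^+ 2 + N0%:R * (b - b') ^+ 2.
Proof.
rewrite rsqn_ip ipE [N%:R * _]mulrC -!sum_const2 -addrA -addrA -[RHS]addrA; congr (_ + _).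
  apply: eq_bigr => i _; apply: eq_bigr => j _.
  by rewrite zWB !zW_mkz !mxE.
rewrite big1 ?add0r => [|i _]; last by rewrite zb1B !zb1_mkz !mxE subr0 mul0r.
rewrite addrC; congr (_ + _).
  by apply: eq_bigr => i _; apply: eq_bigr => j _; rewrite zVB !zV_mkz !mxE.
under eq_bigr do rewrite zb2B !zb2_mkz !mxE.
by rewrite sumr_const card_ord mulr_natl.
Qed.

(** The left-hand side is what the Lyapunov step demands of L below [lyap_max]. On [unif] points,
    paired with one test vector, X enters only through the mean of its entries. *)
Lemma gradient_lipschitz_lower (a LgH : R) :
  (0 < N)%N -> (0 < N0)%N -> (0 < N1)%N -> 0 <= beta -> 0 < a ->
  (forall j n, `|X j n| <= a / 2) ->
  (forall (y y' : zvec R N N0 N1) (m m' : R),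
     (forall j, `|y 0 j| <= a) -> (forall j, `|y' 0 j| <= a) ->
     0 < m < 1 -> 0 < m' < 1 ->
     Num.sqrt (rsqn (m *: gradz (fun w => Htil X beta w m) y
                     - m' *: gradz (fun w => Htil X beta w m') y'))
       <= LgH * dist_zmu y y' m m') ->
  3 / 4 * ((9 / 4 + N1%:R + 2 * N0%:R) * a ^+ 2 / N%:R + 2) <= LgH.
Proof.
move=> hN hN0 hN1 b0 a0 hX H.
have n_p : 0 < N%:R :> R by rewrite ltr0n.
have n0_p : 0 < N0%:R :> R by rewrite ltr0n.
have n1_p : 0 < N1%:R :> R by rewrite ltr0n.
(* This [ev] makes the test vector proportional to the (V, b2)-part of grad F~ at W = a with X
   replaced by its mean: a V-entry is N0 a / N times a b2-entry. *)
pose S := \sum_n \sum_j X j n; pose ev := a * N0%:R / N%:R.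
pose xb := S / (N%:R * N0%:R); pose c1 := beta * (N%:R * N1%:R * ev).
have ev0 : 0 <= ev by apply: divr_ge0; rewrite ?mulr_ge0 // ltW.
have hxb : `|xb| <= a / 2.
  have NN : 0 < N%:R * N0%:R :> R by exact: mulr_gt0.
  rewrite normrM normfV (gtr0_norm NN) ler_pdivrMr // mulrC -sum_const2.
  apply: (le_trans (ler_norm_sum _ _ _)); apply: ler_sum => n _.
  by apply: (le_trans (ler_norm_sum _ _ _)); apply: ler_sum => j _; exact: hX.
have c10 : 0 <= c1.
  by apply: mulr_ge0 => //; apply: mulr_ge0 => //; apply: mulr_ge0; exact: ltW.
apply: (@scalar_lower _ _ _ _ _ xb c1); rewrite ?ler1n //.
move=> w v b m w' v' b' m' hw hv hb hm hw' hv' hb' hm'.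
pose e : zvec R N N0 N1 := mkz 0 0 (const_mx 1) (const_mx ev).
have ugE w1 v1 b1 m1 : uniform_grad N%:R N0%:R N1%:R a xb c1 w1 v1 b1 m1 =
    m1 * dH X beta m1 (unif w1 v1 b1) e.
  rewrite /uniform_grad dH_unif -/S /c1 /xb /ev; congr (_ * _).
  by field; rewrite !gt_eqF.
rewrite !ugE.
have hbox w1 v1 b1 : `|w1| <= a -> `|v1| <= a -> `|b1| <= a -> forall j, `|unif w1 v1 b1 0 j| <= a.
  move=> h1 h2 h3; apply: mkz_entry_le => *; rewrite mxE //.
  by rewrite normr0 ltW.
have /andP[m0 _] := hm; have /andP[m0' _] := hm'.
rewrite -!ip_gradz //.
set g := gradz _ _; set g' := gradz _ _.
rewrite -ip_scaleB.
apply: (le_trans (ip_le_sqrt _ _ _)).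
have -> : rsqn e = N0%:R * (1 + N0%:R * (N1%:R * a ^+ 2 / N%:R)).
  by rewrite /e rsqn_test /ev; field; rewrite gt_eqF.
have := H (unif w v b) (unif w' v' b') m m' (hbox _ _ _ hw hv hb) (hbox _ _ _ hw' hv' hb') hm hm'.
rewrite -/g -/g' /dist_zmu => /(ler_wpM2r (sqrtr_ge0 (N0%:R * (1 + N0%:R * (N1%:R * a ^+ 2 / N%:R))))).
move=> /le_trans; apply.
by rewrite rsqn_unifB [X in _ <= X]mulrA [X in X <= _]mulrAC.
Qed.

End GradientLipschitzLower.

(** * Bounds on bounded sets *)
Section Dominated.
Context {R : realType} {T : Type} (P : T -> Prop).
Implicit Types (f g w : T -> R).

(* Index tuples [t] carry the smoothing parameter and the points, so that the constants
   obtained are uniform in the smoothing parameter. *)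
Definition dominated w f := exists2 C : R, 0 <= C & forall t, P t -> `|f t| <= C * w t.
Definition bounded_on f := dominated (fun=> 1) f.

Lemma dominated_le w f g :
  (forall t, P t -> `|f t| <= `|g t|) -> dominated w g -> dominated w f.
Proof. by move=> fg [C C0 H]; exists C => // t Pt; apply: le_trans (H t Pt); exact: fg. Qed.

Lemma dominated_ext w f g : (forall t, f t = g t) -> dominated w g -> dominated w f.
Proof. by move=> fg; apply: dominated_le => t _; rewrite fg. Qed.

Lemma dominatedD w f g :
  dominated w f -> dominated w g -> dominated w (fun t => f t + g t).
Proof.
move=> [C C0 H] [D D0 H']; exists (C + D); first exact: addr_ge0.
by move=> t Pt; rewrite mulrDl (le_trans (ler_normD _ _)) // lerD ?H ?H'.
Qed.

Lemma dominatedN w f : dominated w f -> dominated w (fun t => - f t).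
Proof. by apply: dominated_le => t _; rewrite normrN. Qed.

Lemma dominatedB w f g :
  dominated w f -> dominated w g -> dominated w (fun t => f t - g t).
Proof. by move=> Hf Hg; apply: dominatedD => //; exact: dominatedN. Qed.

Lemma dominatedM w f g :
  bounded_on f -> dominated w g -> dominated w (fun t => f t * g t).
Proof.
move=> [C C0 H] [D D0 H']; exists (C * D); first exact: mulr_ge0.
move=> t Pt; rewrite normrM -mulrA; have := H t Pt; rewrite mulr1 => h.
exact: ler_pM (H' t Pt).
Qed.

Lemma bounded_cst c : bounded_on (fun=> c).
Proof. by exists `|c| => // t _; rewrite mulr1. Qed.

Lemma dominatedZ w c f : dominated w f -> dominated w (fun t => c * f t).
Proof. by apply: dominatedM; exact: bounded_cst. Qed.

Lemma dominated_sum w (I : finType) (f : I -> T -> R) : (forall t, P t -> 0 <= w t) ->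
  (forall i, dominated w (f i)) -> dominated w (fun t => \sum_i f i t).
Proof.
move=> w0 H.
have H' i : exists c, 0 <= c /\ forall t, P t -> `|f i t| <= c * w t.
  by have [c c0 h] := H i; exists c.
have [C HC] := choice H'.
exists (\sum_i C i); first by apply: sumr_ge0 => i _; have [] := HC i.
move=> t Pt; rewrite mulr_suml (le_trans (ler_norm_sum _ _ _)) //.
by apply: ler_sum => i _; have [_] := HC i; exact.
Qed.

Lemma bounded_sum (I : finType) (f : I -> T -> R) :
  (forall i, bounded_on (f i)) -> bounded_on (fun t => \sum_i f i t).
Proof. by move=> H; apply: dominated_sum. Qed.

End Dominated.

(** * Lipschitz estimates on balls, uniform in the smoothing parameter *)

Section Increments.
Context {R : realType} {N N0 N1 : nat}.
Context (X : 'M[R]_(N0, N)) (lam1 lam2 beta : R).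
Implicit Types (z d : zvec R N N0 N1) (m : R).

Lemma rsqn_ge0 (k : nat) (u : 'rV[R]_k) : 0 <= rsqn u.
Proof. by apply: sumr_ge0 => j _; exact: sqr_ge0. Qed.

Lemma rsqn_sums z : rsqn z = sW z + sb1 z + sb2 z + sV z.
Proof. by rewrite rsqn_ip ipE; congr (_ + _ + _ + _); do ?apply: eq_bigr => ? _; rewrite ?expr2. Qed.

Lemma term_le_sum (I : finType) (f : I -> R) i : (forall j, 0 <= f j) -> f i <= \sum_j f j.
Proof. by move=> f0; rewrite (bigD1 i) //= lerDl sumr_ge0. Qed.

Lemma term_le_sum2 (I J : finType) (f : I -> J -> R) i j :
  (forall i j, 0 <= f i j) -> f i j <= \sum_i \sum_j f i j.
Proof.
move=> f0; apply: le_trans (term_le_sum _ _ i _) => [|k]; last exact: sumr_ge0.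
exact: (term_le_sum _ (f i)).
Qed.

Lemma norm_le_sqrt (a b : R) : a ^+ 2 <= b -> `|a| <= Num.sqrt b.
Proof. by move=> ab; rewrite -sqrtr_sqr ler_wsqrtr. Qed.

Lemma entries_le z :
  [/\ forall i j, `|zW z i j| <= Num.sqrt (rsqn z), forall i, `|zb1 z i 0| <= Num.sqrt (rsqn z),
      forall j, `|zb2 z j 0| <= Num.sqrt (rsqn z) & forall i n, `|zV z i n| <= Num.sqrt (rsqn z)].
Proof.
have h1 := sW_ge0 z; have h2 := sb1_ge0 z; have h3 := sb2_ge0 z; have h4 := sV_ge0 z.
split=> *; apply: norm_le_sqrt; rewrite rsqn_sums.
- apply: (@le_trans _ _ (sW z)); last by lra.
  by apply: (term_le_sum2 _ _ (fun i j => zW z i j ^+ 2)) => *; exact: sqr_ge0.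
- apply: (@le_trans _ _ (sb1 z)); last by lra.
  by apply: (term_le_sum _ (fun i => zb1 z i 0 ^+ 2)) => *; exact: sqr_ge0.
- apply: (@le_trans _ _ (sb2 z)); last by lra.
  by apply: (term_le_sum _ (fun i => zb2 z i 0 ^+ 2)) => *; exact: sqr_ge0.
- apply: (@le_trans _ _ (sV z)); last by lra.
  by apply: (term_le_sum2 _ _ (fun i j => zV z i j ^+ 2)) => *; exact: sqr_ge0.
Qed.

Context (B : R).
(** An index is (mu, (z, z')); [dom f] says that f is O(|z' - z|) with one constant for all mu > 0
    and all points of squared norm at most [B]. *)
Let T : Type := (R * (zvec R N N0 N1 * zvec R N N0 N1))%type.
Let P (t : T) := 0 < t.1 /\ rsqn t.2.1 <= B /\ rsqn t.2.2 <= B.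
Let w (t : T) : R := Num.sqrt (rsqn (t.2.2 - t.2.1)).
Notation dom := (dominated P w).
Notation bdd := (bounded_on P).

Let w_ge0 t : P t -> 0 <= w t.
Proof. by move=> _; exact: sqrtr_ge0. Qed.

Let bnd z : rsqn z <= B -> Num.sqrt (rsqn z) <= Num.sqrt B * 1.
Proof. by move=> h; rewrite mulr1 ler_wsqrtr. Qed.

Lemma bdd_coord (c : zvec R N N0 N1 -> R) : (forall z, `|c z| <= Num.sqrt (rsqn z)) ->
  bdd (fun t => c t.2.1) /\ bdd (fun t => c t.2.2).
Proof.
move=> hc; split; exists (Num.sqrt B); rewrite ?sqrtr_ge0 // => t [_ [h1 h2]];
  exact: le_trans (hc _) (bnd _ _).
Qed.

Lemma dom_coord (c : zvec R N N0 N1 -> R) : (forall z, `|c z| <= Num.sqrt (rsqn z)) ->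
  dom (fun t => c (t.2.2 - t.2.1)).
Proof. by move=> hc; exists 1 => // t _; rewrite mul1r. Qed.

Let cW i j z : `|zW z i j| <= Num.sqrt (rsqn z).
Proof. by have [] := entries_le z. Qed.
Let cb1 i z : `|zb1 z i 0| <= Num.sqrt (rsqn z).
Proof. by have [] := entries_le z. Qed.
Let cb2 j z : `|zb2 z j 0| <= Num.sqrt (rsqn z).
Proof. by have [] := entries_le z. Qed.
Let cV i n z : `|zV z i n| <= Num.sqrt (rsqn z).
Proof. by have [] := entries_le z. Qed.

Lemma bdd_res n j : bdd (fun t => res t.2.1 n j) /\ bdd (fun t => res t.2.2 n j).
Proof.
split; (apply: dominatedD; [apply: bounded_sum => i; apply: dominatedM|]).
- exact: (bdd_coord _ (cW i j)).1.
- exact: (bdd_coord _ (cV i n)).1.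
- exact: (bdd_coord _ (cb2 j)).1.
- exact: (bdd_coord _ (cW i j)).2.
- exact: (bdd_coord _ (cV i n)).2.
- exact: (bdd_coord _ (cb2 j)).2.
Qed.

Lemma dom_res n j : dom (fun t => res t.2.2 n j - res t.2.1 n j).
Proof.
apply: (dominated_ext _ _ _ (fun t => \sum_i (zW t.2.2 i j * zV (t.2.2 - t.2.1) i n
   + zV t.2.1 i n * zW (t.2.2 - t.2.1) i j) + zb2 (t.2.2 - t.2.1) j 0)).
  move=> t; rewrite zb2B /res opprD addrACA -sumrB; congr (_ + _).
  by apply: eq_bigr => i _; rewrite zWB zVB; ring.
apply: dominatedD; last exact: (dom_coord _ (cb2 j)).
apply: dominated_sum => // i; apply: dominatedD; apply: dominatedM.
- exact: (bdd_coord _ (cW i j)).2.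
- exact: (dom_coord _ (cV i n)).
- exact: (bdd_coord _ (cV i n)).1.
- exact: (dom_coord _ (cW i j)).
Qed.

Lemma dom_pre n i : dom (fun t => pre X (t.2.2 - t.2.1) n i).
Proof.
apply: dominatedD; last exact: (dom_coord _ (cb1 i)).
apply: dominated_sum => // j.
apply: (dominated_ext _ _ _ (fun t => X j n * zW (t.2.2 - t.2.1) i j)) => [t|].
  by rewrite mulrC.
by apply: dominatedZ; exact: (dom_coord _ (cW i j)).
Qed.

Lemma preB z d n i : pre X (z - d) n i = pre X z n i - pre X d n i.
Proof. by rewrite -scaleN1r pre_line mulN1r. Qed.

Lemma norm_pos_le (a : R) : `|pp a| <= `|a|.
Proof. by have := pos_lip a 0; rewrite maxxx !subr0. Qed.

(** [sigt] is 1-Lipschitz for every mu, so the smoothing does not make the constant depend on mu. *)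
Lemma dom_Hval : dom (fun t => Hval X beta t.1 t.2.2 - Hval X beta t.1 t.2.1).
Proof.
apply: (dominated_ext _ _ _ (fun t =>
  N%:R^-1 * \sum_n \sum_j ((pp (res t.2.2 n j) + pp (res t.2.1 n j))
      * (pp (res t.2.2 n j) - pp (res t.2.1 n j))
    - 2 * X j n * (sigt t.1 (res t.2.2 n j) - sigt t.1 (res t.2.1 n j)))
  + beta * \sum_n \sum_i (zV (t.2.2 - t.2.1) i n
      - (sigt t.1 (pre X t.2.2 n i) - sigt t.1 (pre X t.2.1 n i))))).
  move=> t; rewrite /Hval opprD addrACA -!mulrBr -!sumrB; congr (_ * _ + _ * _);
  apply: eq_bigr => n _; rewrite -sumrB; apply: eq_bigr => j _; first by ring.
  by rewrite zVB; ring.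
apply: dominatedD; apply: dominatedZ; apply: dominated_sum => // n; apply: dominated_sum => // j.
  apply: dominatedB; [apply: dominatedM; [apply: dominatedD|]|apply: dominatedZ].
  - by apply: dominated_le (bdd_res n j).2 => t _; exact: norm_pos_le.
  - by apply: dominated_le (bdd_res n j).1 => t _; exact: norm_pos_le.
  - by apply: dominated_le (dom_res n j) => t _; exact: pos_lip.
  - by apply: dominated_le (dom_res n j) => t [m0 _]; exact: sigt_lip.
apply: dominatedB; first exact: (dom_coord _ (cV j n)).
by apply: dominated_le (dom_pre n j) => t [m0 _]; rewrite preB; exact: sigt_lip.
Qed.

Lemma norm_dsigt_le1 m a : 0 < m -> `|dsigt m a| <= 1.
Proof. by move=> m0; rewrite ger0_norm ?dsigt_ge0 // dsigt_le1. Qed.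

Lemma bdd_dsigt (f : T -> R) : bdd (fun t => dsigt t.1 (f t)).
Proof. by exists 1 => // t [m0 _]; rewrite mulr1; exact: norm_dsigt_le1. Qed.

(** [dsigt] has values in [0, 1]: the gradient is bounded uniformly in mu, although its Lipschitz
    constant is not. *)
Lemma dom_dH : dom (fun t => dH X beta t.1 t.2.1 (t.2.2 - t.2.1)).
Proof.
apply: dominatedD; apply: dominatedZ; apply: dominated_sum => // n; apply: dominated_sum => // j.
  apply: dominatedM; first apply: dominatedB.
  - by apply: dominated_le (bdd_res n j).1 => t _; exact: norm_pos_le.
  - by apply: dominatedZ; exact: bdd_dsigt.
  - apply: dominatedD; last exact: (dom_coord _ (cb2 j)).
    apply: dominated_sum => // i.
    apply: (dominated_ext _ _ _ (fun t => zV t.2.1 i n * zW (t.2.2 - t.2.1) i j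
      + zW t.2.1 i j * zV (t.2.2 - t.2.1) i n)) => [t|]; first by rewrite mulrC.
    apply: dominatedD; apply: dominatedM.
    + exact: (bdd_coord _ (cV i n)).1.
    + exact: (dom_coord _ (cW i j)).
    + exact: (bdd_coord _ (cW i j)).1.
    + exact: (dom_coord _ (cV i n)).
apply: dominatedB; first exact: (dom_coord _ (cV j n)).
by apply: dominatedM; [exact: bdd_dsigt|exact: dom_pre].
Qed.

Lemma dom_Robj : dom (fun t => Robj lam1 lam2 t.2.2 - Robj lam1 lam2 t.2.1).
Proof.
apply: (dominated_ext _ _ _ (fun t => lam1 * (\sum_n \sum_i zV (t.2.2 - t.2.1) i n)
  + lam2 * (\sum_i \sum_j (zW t.2.2 i j + zW t.2.1 i j) * zW (t.2.2 - t.2.1) i j))).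
  move=> t; rewrite !RobjE opprD addrACA -!mulrBr -!sumrB; congr (_ * _ + _ * _);
  apply: eq_bigr => n _; rewrite -sumrB; apply: eq_bigr => j _; first by rewrite zVB.
  by rewrite zWB; ring.
apply: dominatedD; apply: dominatedZ; apply: dominated_sum => // i; apply: dominated_sum => // j.
  exact: (dom_coord _ (cV j i)).
apply: dominatedM; last exact: (dom_coord _ (cW i j)).
by apply: dominatedD; [exact: (bdd_coord _ (cW i j)).2|exact: (bdd_coord _ (cW i j)).1].
Qed.

(* Minimality against [z] itself gives a step of length O(1/L). *)
Lemma spg_increment : exists2 C, 0 <= C & forall m L z z', 0 < m -> 0 < L ->
  rsqn z <= B -> rsqn z' <= B ->
  spg_sub X lam1 lam2 beta z m L z' <= spg_sub X lam1 lam2 beta z m L z ->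
  Otil X lam1 lam2 beta z' m - Otil X lam1 lam2 beta z m <= C / L.
Proof.
have [C1 C10 H1] := dom_Hval; have [C2 C20 H2] := dom_dH; have [C3 C30 H3] := dom_Robj.
exists ((C1 + C3) * (2 * (C2 + C3))).
  by rewrite mulr_ge0 ?addr_ge0 // mulr_ge0 // addr_ge0.
move=> m L z z' m0 L0 zB zB' hmin.
have Pt : P (m, (z, z')) by [].
have h1 := H1 _ Pt; have h2 := H2 _ Pt; have h3 := H3 _ Pt; move: h1 h2 h3.
rewrite /w /= !OtilE.
have : rsqn (z' - z) = Num.sqrt (rsqn (z' - z)) ^+ 2 by rewrite sqr_sqrtr // rsqn_ge0.
move: hmin; rewrite /spg_sub !ip_gradz // subrr.
have -> : dH X beta m z 0 = 0.
  by have := dH_lin X beta m z (-1) 0 0; rewrite scaler0 addr0; lra.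
have -> : rsqn (0 : zvec R N N0 N1) = 0 by rewrite /rsqn big1 // => j _; rewrite mxE expr0n.
move: (sqrtr_ge0 (rsqn (z' - z))).
move: (dH X beta m z (z' - z)) (Hval X beta m z') (Hval X beta m z) => dh h' h.
move: (Robj lam1 lam2 z') (Robj lam1 lam2 z) => r' r.
move: (rsqn (z' - z)) (Num.sqrt (rsqn (z' - z))) => q s s0 hmin qs; move: hmin; rewrite {}qs => hmin.
 rewrite !ler_norml => /andP[_ a1] /andP[a2 _] /andP[a3 a4].
have hs : s * (L * s) <= s * (2 * (C2 + C3)) by nra.
have sL : s * L <= 2 * (C2 + C3).
  move: s0; rewrite le_eqVlt => /orP[/eqP <-|s0]; first by rewrite mul0r mulr_ge0 // addr_ge0.
  by rewrite mulrC -(ler_pM2l s0).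
apply: (@le_trans _ _ ((C1 + C3) * s)); first by lra.
by rewrite -mulrA ler_wpM2l ?addr_ge0 // ler_pdivlMr.
Qed.

End Increments.

(** * Smoothed versus original objective *)

Section Comparison.
Context {R : realType} {N N0 N1 : nat}.
Context (X : 'M[R]_(N0, N)) (lam1 lam2 beta : R).
Implicit Types (z d : zvec R N N0 N1) (m : R).

(** After expanding ((y)_+ - x)^2, the two objectives differ only in terms linear in (y)_+ -
    sigma~(y, mu), which lies in [0, mu/2]. *)
Lemma Otil_sub_Oobj : exists2 C, 0 <= C & forall m z, 0 < m ->
  `|Otil X lam1 lam2 beta z m - Oobj X lam1 lam2 beta z| <= C * m.
Proof.
pose P (t : R * zvec R N N0 N1) := 0 < t.1.
suff [C C0 H] : dominated P (fun t => t.1)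
    (fun t => Otil X lam1 lam2 beta t.2 t.1 - Oobj X lam1 lam2 beta t.2).
  by exists C => // m z m0; exact: (H (m, z) m0).
have gap (f : R * zvec R N N0 N1 -> R) : dominated P (fun t => t.1)
    (fun t => pp (f t) - sigt t.1 (f t)).
  exists 1 => // t m0; have := pos_sub_sigt_le t.1 (f t) m0; have := sigt_le_pos t.1 (f t) m0.
  by rewrite /P in m0 *; rewrite ler_norml => *; apply/andP; split; lra.
apply: (dominated_ext _ _ _ (fun t =>
  N%:R^-1 * \sum_n \sum_j (2 * X j n * (pp (res t.2 n j) - sigt t.1 (res t.2 n j)))
  + beta * \sum_n \sum_i (pp (pre X t.2 n i) - sigt t.1 (pre X t.2 n i)))).
  move=> t; rewrite OtilE OobjE /Hval.
  set r := Robj _ _ _; set A := \sum_n \sum_j _; set B := \sum_n \sum_i _.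
  set A' := \sum_n \sum_j _; set B' := \sum_n \sum_i _.
  have -> : N%:R^-1 * A + beta * B + r - (N%:R^-1 * A' + r + beta * B') =
    N%:R^-1 * (A - A') + beta * (B - B') by ring.
  rewrite /A /B /A' /B' -!sumrB; congr (_ * _ + _ * _); apply: eq_bigr => n _;
  by rewrite -sumrB; apply: eq_bigr => j _; ring.
have w0 t : P t -> 0 <= t.1 by move=> /ltW.
apply: dominatedD; apply: dominatedZ; apply: dominated_sum => // n; apply: dominated_sum => // j.
by apply: dominatedZ; exact: gap.
Qed.

Lemma Robj_ge0 z : 0 <= lam1 -> 0 <= lam2 -> Omega2 X z -> 0 <= Robj lam1 lam2 z.
Proof.
move=> l1 l2 /Omega2_zV_ge0 v0; rewrite RobjE.
by rewrite addr_ge0 ?mulr_ge0 ?sW_ge0 // -/(tV z) tV_ge0.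
Qed.

(** For x > 0, sigma~ <= (y)_+ makes the data term at least ((y)_+ - x)^2; for x <= 0 every summand
    is nonnegative. The same comparison handles the penalty on Omega2. *)
Lemma Otil_ge0 m z : 0 <= lam1 -> 0 <= lam2 -> 0 <= beta -> 0 < m -> Omega2 X z ->
  0 <= Otil X lam1 lam2 beta z m.
Proof.
move=> l1 l2 b0 m0 Oz; rewrite OtilE addr_ge0 ?Robj_ge0 //.
apply: addr_ge0; apply: mulr_ge0 => //; rewrite ?invr_ge0 //;
  apply: sumr_ge0 => n _; apply: sumr_ge0 => j _.
  have := sigt_ge0 m (res z n j) m0; have := sigt_le_pos m (res z n j) m0.
  set r := res z n j; set x := X j n; have := pos_ge0 r; set y := pp r; set s := sigt _ _ => *.
  have [x0|x0] := leP x 0; first by have := sqr_ge0 y; have := sqr_ge0 x; nra.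
  by have := sqr_ge0 (y - x); nra.
move: Oz => /Omega2P /(_ n j); have := sigt_le_pos m (pre X z n j) m0; lra.
Qed.

Lemma Robj_le_Oobj z : 0 <= beta -> Omega2 X z -> Robj lam1 lam2 z <= Oobj X lam1 lam2 beta z.
Proof.
move=> b0 /Omega2P Oz; rewrite OobjE -addrA addrCA lerDl; apply: addr_ge0;
  apply: mulr_ge0; rewrite ?invr_ge0 //; apply: sumr_ge0 => n _; apply: sumr_ge0 => j _.
  exact: sqr_ge0.
by rewrite subr_ge0.
Qed.

End Comparison.

(** * The smoothing schedule *)
Section Schedule.
Context {R : realType}.

Lemma nonincreasing_steps (u : nat -> R) : (forall k, u k.+1 <= u k) ->
  {homo u : n m / (n <= m)%N >-> m <= n}.
Proof. by move=> H; apply: homo_leq => // [x y z0 h1 h2]; exact: le_trans h2 h1. Qed.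

Lemma geometric_schedule_cvg0 (mu : nat -> R) (tau1 : R) : 0 < tau1 < 1 ->
  0 < mu 0%N -> (forall k, mu k.+1 = mu k \/ mu k.+1 = tau1 * mu k) ->
  (forall k, exists2 j, (k <= j)%N & mu j.+1 = tau1 * mu j) ->
  mu n @[n --> \oo] --> 0.
Proof.
move=> /andP[t0 t1] m0 hmu hinf.
have mup k : 0 < mu k.
  by elim: k => // k IH; have [->|->] := hmu k => //; rewrite mulr_gt0.
have mudec k : mu k.+1 <= mu k.
  by have [->|->] := hmu k => //; rewrite ger_pMl // ltW.
have mono := nonincreasing_steps _ mudec.
have geo p : exists K, forall k, (K <= k)%N -> mu k <= mu 0%N * tau1 ^+ p.
  elim: p => [|p [K HK]]; first by exists 0%N => k _; rewrite mulr1; exact: mono.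
  have [j Kj hj] := hinf K; exists j.+1 => k jk.
  rewrite (le_trans (mono _ _ jk)) // hj exprS mulrCA ler_wpM2l ?(ltW t0) //.
  exact: HK.
apply/cvgrPdist_lt => e e0.
have /cvgrPdist_lt /(_ e e0) [p _ Hp] : mu 0%N * tau1 ^+ n @[n --> \oo] --> 0.
  rewrite -[X in _ --> X](mulr0 (mu 0%N)); apply: cvgMr; apply: cvg_expr.
  by rewrite ger0_norm // ltW.
have [K HK] := geo p; exists K => // k /= Kk.
have := Hp p (leqnn p); rewrite /= !sub0r !normrN !ger0_norm ?mulr_ge0 ?exprn_ge0 ?(ltW _) //.
by apply: le_lt_trans; exact: HK.
Qed.

(** [F k m] stands for O~(z^k, m) and [ob k] for O(z^k). The bound on [tau1 * tau3] keeps
    [mu k * L k] from falling below its initial value, which turns 1/L into O(mu). *)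
Lemma smoothing_schedule (F : nat -> R -> R) (ob mu L : nat -> R)
    (tau1 tau2 tau3 Cg Ci : R) :
  0 < tau1 < 1 -> 0 < tau2 -> 1 <= tau3 -> 1 <= tau1 * tau3 ->
  0 < mu 0%N -> 0 < L 0%N -> 0 <= Cg -> 0 <= Ci ->
  (forall k m, 0 < m -> 0 <= F k m) ->
  (forall k m, 0 < m -> `|F k m - ob k| <= Cg * m) ->
  (forall k, 0 < mu k -> 0 < L k -> L 0%N <= L k -> F k.+1 (mu k) - F k (mu k) <= Ci / L k) ->
  (forall k, (mu k.+1, L k.+1) =
     if F k.+1 (mu k) - F k (mu k) < - (tau2 * mu k / L k)
     then (mu k, L k) else (tau1 * mu k, tau3 * L k)) ->
  [/\ mu n @[n --> \oo] --> 0, cvgn ob, cvgn (fun k => F k (mu k)) &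
      limn (fun k => F k (mu k)) = limn ob].
Proof.
move=> t01 t2 t3 t13 m0 L0 Cg0 Ci0 F0 Fob Finc step.
have /andP[t0 t1] := t01.
pose red k := ~~ (F k.+1 (mu k) - F k (mu k) < - (tau2 * mu k / L k)).
have stepN k : ~~ red k -> mu k.+1 = mu k /\ L k.+1 = L k.
  by rewrite /red negbK => h; have := step k; rewrite h => -[-> ->].
have stepR k : red k -> mu k.+1 = tau1 * mu k /\ L k.+1 = tau3 * L k.
  by rewrite /red => h; have := step k; rewrite (negbTE h) => -[-> ->].
have inv k : [/\ 0 < mu k, L 0%N <= L k & mu 0%N * L 0%N <= mu k * L k].
  elim: k => [|k [h1 h2 h3]]; first by [].
  have [r|r] := boolP (red k).
    have [-> ->] := stepR _ r; split; first exact: mulr_gt0.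
      by apply: (le_trans h2); rewrite ler_peMl // (le_trans (ltW L0)).
    rewrite mulrACA (le_trans h3) // ler_peMl //.
    by rewrite mulr_ge0 ?(ltW h1) // (le_trans (ltW L0)).
  by have [-> ->] := stepN _ r.
have mup k : 0 < mu k by have [] := inv k.
have Lp k : 0 < L k by have [_ h _] := inv k; exact: lt_le_trans h.
have hinf k : exists2 j, (k <= j)%N & red j.
  apply: contrapT => H.
  have nr j : (k <= j)%N -> ~~ red j.
    by move=> kj; apply/negP => r; apply: H; exists j.
  have cst i : mu (k + i)%N = mu k /\ L (k + i)%N = L k.
    elim: i => [|i [h1 h2]]; first by rewrite addn0.
    by rewrite addnS; have [-> ->] := stepN _ (nr _ (leq_addr i k)).
  pose d := tau2 * mu k / L k.
  have d0 : 0 < d by rewrite divr_gt0 ?mulr_gt0.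
  have dec i : F (k + i)%N (mu k) <= F k (mu k) - d * i%:R.
    elim: i => [|i IH]; first by rewrite addn0 mulr0 subr0.
    have := nr _ (leq_addr i k); rewrite /red negbK addnS.
    have [-> ->] := cst i; rewrite -/d -natr1 mulrDr mulr1; lra.
  have [i Hi] : exists i : nat, F k (mu k) < d * i%:R.
    exists (Num.bound (F k (mu k) / d)).
    rewrite mulrC -ltr_pdivrMr //; apply: archi_boundP.
    by apply: divr_ge0; [exact: F0|exact: ltW].
  have := F0 (k + i)%N _ (mup k); have := dec i; lra.
have mu0 : mu n @[n --> \oo] --> 0.
  apply: (geometric_schedule_cvg0 _ _ t01 m0) => k.
    by have [r|r] := boolP (red k); [right|left]; [have [] := stepR _ r|have [] := stepN _ r].
  by have [j kj r] := hinf k; exists j => //; have [] := stepR _ r.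
(* Increase at a reduction per unit of [mu k]: the step costs Ci / (mu0 L0), and replacing mu by
   tau1 mu costs at most 2 Cg, compared through [ob]. The drop of [Cs * mu] pays for both
   exactly. *)
pose C1 := Ci / (mu 0%N * L 0%N) + 2 * Cg.
have mL : 0 < mu 0%N * L 0%N by exact: mulr_gt0.
have C10 : 0 <= C1 by rewrite addr_ge0 ?mulr_ge0 // invr_ge0 ltW.
pose Cs := C1 / (1 - tau1).
have Cs0 : 0 <= Cs by rewrite divr_ge0 // subr_ge0 ltW.
pose S k := F k (mu k) + Cs * mu k.
have Sdec k : S k.+1 <= S k.
  rewrite /S; have [r|r] := boolP (red k); last first.
    have [-> _] := stepN _ r; move: r; rewrite /red negbK lerD2r => r.
    have : 0 < tau2 * mu k / L k by rewrite divr_gt0 ?mulr_gt0.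
    lra.
  have [-> _] := stepR _ r.
  have mt : 0 < tau1 * mu k by exact: mulr_gt0.
  have h1 := Fob k.+1 _ mt; have h2 := Fob k.+1 _ (mup k).
  have [_ LL mLk] := inv k.
  have h3 := Finc k (mup k) (Lp k) LL.
  have h4 : Ci / L k <= Ci / (mu 0%N * L 0%N) * mu k.
    rewrite -mulrA ler_wpM2l // ler_pdivlMl // ler_pdivrMr //.
  have h5 : Cs * mu k - Cs * (tau1 * mu k) = C1 * mu k.
    by rewrite /Cs; field; rewrite subr_eq0 gt_eqF.
  have h6 : Cg * (tau1 * mu k) <= Cg * mu k.
    by rewrite ler_wpM2l // ler_piMl // ltW.
  move: h1 h2; rewrite !ler_norml => /andP[_ h1] /andP[h2 _].
  have h7 : C1 * mu k = Ci / (mu 0%N * L 0%N) * mu k + 2 * (Cg * mu k).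
    by rewrite /C1; ring.
  clear -h1 h2 h3 h4 h5 h6 h7; lra.
have Scvg : cvgn S.
  apply: nonincreasing_is_cvgn; first exact: nonincreasing_steps.
  exists 0 => _ [k _ <-]; apply: addr_ge0; first exact: F0.
  by apply: mulr_ge0 => //; exact: ltW.
have FE : (fun k => F k (mu k)) = S \- (fun k => Cs * mu k).
  by apply/funext => i; rewrite /S /= addrK.
have Cmu c : c * mu n @[n --> \oo] --> 0.
  by rewrite -[X in _ --> X](mulr0 c); apply: cvgMr.
have Flim : F k (mu k) @[k --> \oo] --> limn S.
  by rewrite FE -[X in _ --> X]subr0; apply: cvgB; [exact: Scvg|exact: Cmu].
have oblim : ob k @[k --> \oo] --> limn S.
  have dlim : (F k (mu k) - ob k) @[k --> \oo] --> 0.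
    apply/norm_cvg0P; apply: (@squeeze_cvgr _ _ _ _ (fun=> 0) (fun k => Cg * mu k)).
    - by near=> k; rewrite normr_ge0 /=; exact: Fob.
    - exact: cvg_cst.
    - exact: Cmu.
  have -> : ob = (fun k => F k (mu k)) \- (fun k => F k (mu k) - ob k).
    by apply/funext => i /=; rewrite subKr.
  by rewrite -[X in _ --> X]subr0; apply: cvgB; [exact: Flim|exact: dlim].
split=> //; [exact: cvgP oblim|exact: cvgP Flim|].
by rewrite (cvg_lim _ Flim) // (cvg_lim _ oblim).
Unshelve. all: by end_near. Qed.

End Schedule.

(** * Boundedness of the iterates *)
Lemma norm1_ge_entry {R : realType} {N N0 : nat} (X : 'M[R]_(N0, N)) j n :
  `|X j n| <= norm1 X.
Proof.
apply: (@le_trans _ _ (\sum_i `|X i n|)).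
  by apply: (term_le_sum _ (fun i => `|X i n|)).
by rewrite /norm1; apply: (le_bigmax_cond _ (fun n => \sum_i `|X i n|)).
Qed.

Lemma frob2_ge_entry {R : realType} {N N0 : nat} (X : 'M[R]_(N0, N)) j n :
  X j n ^+ 2 <= frob2 X.
Proof. by apply: (term_le_sum2 _ _ (fun j n => X j n ^+ 2)) => *; exact: sqr_ge0. Qed.

Lemma frob2_ge0 {R : realType} {N N0 : nat} (X : 'M[R]_(N0, N)) : 0 <= frob2 X.
Proof. by apply: sumr_ge0 => i _; apply: sumr_ge0 => j _; exact: sqr_ge0. Qed.

Lemma norm1_ge0 {R : realType} {N N0 : nat} (X : 'M[R]_(N0, N)) : 0 <= norm1 X.
Proof. exact: bigmax_ge_id. Qed.

(** * The thresholds alpha and eta *)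

Section Constants.
Context {R : realType} (N N0 N1 : nat) (X : 'M[R]_(N0, N)) (lam1 lam2 theta : R).

Lemma eta_props : (0 < N0)%N -> (0 < N1)%N -> 0 < lam1 -> 0 < lam2 -> 0 < theta ->
  let eta := eta_c N0 N1 lam1 lam2 theta in
  [/\ 0 < eta, theta <= lam2 * eta ^+ 2 & theta <= lam1 * eta].
Proof.
move=> hN0 hN1 l1 l2 t0 eta.
have e1 : theta / lam1 <= eta by rewrite le_max lexx orbT.
have e2 : Num.sqrt ((N1 * N0)%:R * theta / lam2) <= eta by rewrite le_max lexx.
have e0 : 0 < eta by apply: lt_le_trans e1; exact: divr_gt0.
split=> //; last by rewrite mulrC -ler_pdivrMr.
rewrite mulrC -ler_pdivrMr //.
have q0 : 0 <= (N1 * N0)%:R * theta / lam2 by rewrite !mulr_ge0 ?invr_ge0 // ltW.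
apply: (@le_trans _ _ ((N1 * N0)%:R * theta / lam2)).
  rewrite ler_pM2r ?invr_gt0 //; apply: ler_peMl; first exact: ltW.
  by rewrite ler1n muln_gt0 hN1 hN0.
by rewrite -(sqr_sqrtr q0) ler_sqr ?nnegrE ?sqrtr_ge0 // ltW.
Qed.

(** The second branch of alpha contains both sqrt(N theta) and the column-sum norm, each of which
    dominates every entry of |X|; hence the factor 1/2. *)
Lemma alpha_props : (0 < N)%N -> 0 < lam1 -> 0 < lam2 -> N%:R^-1 * frob2 X < theta ->
  let alpha := alpha_c N1 X lam1 lam2 theta in
  0 < alpha /\ forall j n, `|X j n| <= alpha / 2.
Proof.
move=> hN l1 l2 ht alpha.
have n_p : 0 < N%:R :> R by rewrite ltr0n.
have t0 : 0 < theta.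
  by apply: le_lt_trans ht; rewrite mulr_ge0 ?invr_ge0 ?frob2_ge0.
split.
  have : theta / lam1 + Num.sqrt ((N1 * N0)%:R * theta / lam2) * norm1 X <= alpha.
    by rewrite le_max lexx.
  apply: lt_le_trans; apply: ltr_wpDr; last exact: divr_gt0.
  by rewrite mulr_ge0 ?sqrtr_ge0 ?norm1_ge0.
move=> j n.
have h1 := norm1_ge_entry X j n.
have h2 : `|X j n| <= Num.sqrt (N%:R * theta).
  apply: norm_le_sqrt; apply: (le_trans (frob2_ge_entry X j n)).
  by rewrite -ler_pdivrMl // ltW.
have h3 : Num.sqrt (N%:R * theta) + norm1 X <= alpha.
  apply: (@le_trans _ _ (theta * Num.sqrt ((N1 * N0)%:R * theta) / (lam1 * Num.sqrt lam2)
             + Num.sqrt (N%:R * theta) + norm1 X)).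
    rewrite lerD2r lerDr divr_ge0 ?mulr_ge0 ?sqrtr_ge0 ?ltW //.
  by rewrite le_max lexx orbT.
by rewrite ler_pdivlMr //; lra.
Qed.

End Constants.

(** * Invariance of the Lyapunov sublevel set *)

Section Invariant.
Context {R : realType} {N N0 N1 : nat}.
Context (X : 'M[R]_(N0, N)) (lam1 lam2 beta theta al et L LgH : R).
Implicit Types (z : zvec R N N0 N1).

Definition lyap_max : R := 9 * et ^+ 2 + (N1%:R + 2 * N0%:R) * al ^+ 2.

Lemma lyap_of_sublevel z : 0 < lam1 -> 0 < lam2 -> 0 < theta -> 0 <= al -> 0 < et ->
  theta <= lam2 * et ^+ 2 -> theta <= lam1 * et -> Zset X al z ->
  2 * lam2 * sW z + lam1 * tV z <= 3 * theta -> lyap z <= lyap_max.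
Proof.
move=> l1 l2 t0 al0 e0 h1 h2 [Z2 Z3] h.
have v0 := Omega2_zV_ge0 _ _ Z2.
have := sWsV_sublevel _ _ _ _ _ e0 t0 h1 h2 v0 h.
have := lyap_box _ _ al0 Z3; rewrite /lyap_max; lra.
Qed.

(** Either 2 lam2 |W|^2 + lam1 e^T V <= 3 theta at [z], and the bound is direct, or [lyap_step]
    keeps [lyap] from increasing. *)
Lemma lyap_invariant m zk z : (0 < N)%N ->
  0 < lam1 -> 0 < lam2 -> 0 <= beta -> 0 < theta -> 0 <= al -> 0 < et ->
  theta <= lam2 * et ^+ 2 -> theta <= lam1 * et ->
  N%:R^-1 * frob2 X < theta -> 0 < m -> 0 < L ->
  3 / 4 * ((9 / 4 + N1%:R + 2 * N0%:R) * Num.max al (2 * et) ^+ 2 / N%:R + 2) <= L ->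
  Zset X al z ->
  (forall y, Zset X al y -> spg_sub X lam1 lam2 beta zk m L z
                             <= spg_sub X lam1 lam2 beta zk m L y) ->
  lyap zk <= lyap_max -> lyap z <= lyap_max.
Proof.
move=> hN l1 l2 b0 t0 al0 e0 h1 h2 hX m0 L0 hL Zz H hk.
have n_p : 0 < N%:R :> R by rewrite ltr0n.
set a := Num.max al (2 * et) in hL.
have a1 : al ^+ 2 <= a ^+ 2.
  by rewrite ler_sqr ?nnegrE ?le_max ?lexx ?al0.
have a2 : (2 * et) ^+ 2 <= a ^+ 2.
  by rewrite ler_sqr ?nnegrE ?le_max ?lexx ?al0 ?orbT // mulr_ge0 // ltW.
have hS : sV zk + sW zk + 2 * N%:R <= 4 / 3 * N%:R * L.
  have h3 : sV zk + sW zk <= lyap_max.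
    by move: hk; rewrite /lyap; have := sb1_ge0 zk; have := sb2_ge0 zk; lra.
  (* 9 eta^2 = 9/4 (2 eta)^2 is the origin of 9/4, as alpha and 2 eta are both compared with [a]. *)
  have h4 : lyap_max <= (9 / 4 + N1%:R + 2 * N0%:R) * a ^+ 2.
    have c0 : 0 <= N1%:R + 2 * N0%:R :> R by rewrite addr_ge0 // mulr_ge0.
    have := ler_wpM2l c0 a1; rewrite /lyap_max; lra.
  have n43 : 0 <= 4 / 3 * N%:R :> R by rewrite mulr_ge0 //; lra.
  have h5 := ler_wpM2l n43 hL.
  have h6 : 4 / 3 * N%:R * (3 / 4 * ((9 / 4 + N1%:R + 2 * N0%:R) * a ^+ 2 / N%:R + 2)) =
     (9 / 4 + N1%:R + 2 * N0%:R) * a ^+ 2 + 2 * N%:R by field; rewrite gt_eqF.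
  by rewrite h6 in h5; lra.
have step := lyap_step _ _ _ _ _ _ _ _ _ hN b0 al0 m0 L0 Zz H hS.
have [hs|hs] := leP (2 * lam2 * sW z + lam1 * tV z) (3 * theta).
  exact: lyap_of_sublevel hs.
apply: le_trans hk; rewrite -subr_le0.
have L2 : 0 < L / 2 by rewrite divr_gt0.
by rewrite -(pmulr_rle0 _ L2); lra.
Qed.

End Invariant.

Theorem theorem3p1 (R : realType) (N N0 N1 : nat) (X : 'M[R]_(N0, N))
  (lam1 lam2 beta theta : R) (LH LgH : R)
  (tau1 tau2 tau3 : R)
  (z : nat -> zvec R N N0 N1) (mu Lk : nat -> R) :
  (0 < N)%N -> (0 < N0)%N -> (0 < N1)%N ->
  0 < lam1 -> 0 < lam2 -> 0 < beta ->
  N%:R^-1 * frob2 X < theta ->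
  (* L_H~ : Lipschitz constant of (z,mu) |-> mu * H~(z,mu) on (Omega_theta ∩ Z) x (0,1) *)
  (forall (y y' : zvec R N N0 N1) (m m' : R),
     Omega_theta X lam1 lam2 beta theta y -> Zset X (alpha_c N1 X lam1 lam2 theta) y ->
     Omega_theta X lam1 lam2 beta theta y' -> Zset X (alpha_c N1 X lam1 lam2 theta) y' ->
     0 < m < 1 -> 0 < m' < 1 ->
     `|m * Htil X beta y m - m' * Htil X beta y' m'| <= LH * dist_zmu y y' m m') ->
  (* L_grad H~ : Lipschitz constant of (z,mu) |-> mu * grad_z H~(z,mu)
     on {||z||_inf <= max(alpha, 2 eta)} x (0,1) *)
  (forall (y y' : zvec R N N0 N1) (m m' : R),
     (forall j, `|y 0 j| <= Num.max (alpha_c N1 X lam1 lam2 theta) (2 * eta_c N0 N1 lam1 lam2 theta)) ->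
     (forall j, `|y' 0 j| <= Num.max (alpha_c N1 X lam1 lam2 theta) (2 * eta_c N0 N1 lam1 lam2 theta)) ->
     0 < m < 1 -> 0 < m' < 1 ->
     Num.sqrt (rsqn (m *: gradz (fun w => Htil X beta w m) y
                     - m' *: gradz (fun w => Htil X beta w m') y'))
       <= LgH * dist_zmu y y' m m') ->
  (* algorithm parameters *)
  0 < tau1 < 1 -> 0 < tau2 -> 1 <= tau3 ->
  Zset X (alpha_c N1 X lam1 lam2 theta) (z 0%N) ->
  0 < mu 0%N < 1 -> 1 <= Lk 0%N ->
  (* SPG iterations *)
  (forall k : nat,
     Zset X (alpha_c N1 X lam1 lam2 theta) (z k.+1) /\
     forall y : zvec R N N0 N1, Zset X (alpha_c N1 X lam1 lam2 theta) y ->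
       spg_sub X lam1 lam2 beta (z k) (mu k) (Lk k) (z k.+1)
         <= spg_sub X lam1 lam2 beta (z k) (mu k) (Lk k) y) ->
  (forall k : nat,
     (mu k.+1, Lk k.+1) =
       (if Otil X lam1 lam2 beta (z k.+1) (mu k) - Otil X lam1 lam2 beta (z k) (mu k)
             < - (tau2 * mu k / Lk k)
        then (mu k, Lk k) else (tau1 * mu k, tau3 * Lk k))) ->
  (* hypotheses of the theorem *)
  Oobj X lam1 lam2 beta (z 0%N) < theta ->
  1 <= tau1 * tau3 ->
  Num.max (6 * lam2 * (N1 * N0)%:R
             + 2 / eta_c N0 N1 lam1 lam2 theta
                 * ((N2 N N0 N1)%:R * LH + lam1 * (N1 * N)%:R))
          (8 * lam2 + LgH)
    <= mu 0%N * Lk 0%N ->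
  (* conclusions *)
  mu n @[n --> \oo] --> 0 /\
  cvgn (fun k => Oobj X lam1 lam2 beta (z k)) /\
  cvgn (fun k => Otil X lam1 lam2 beta (z k) (mu k)) /\
  limn (fun k => Otil X lam1 lam2 beta (z k) (mu k)) =
  limn (fun k => Oobj X lam1 lam2 beta (z k)).
Proof.
move=> hN hN0 hN1 l1 l2 b0 hX _ hLg ht1 ht2 ht3 Z0 hm0 hL0 hmin hstep hO t13 hmL.
set al := alpha_c N1 X lam1 lam2 theta in hLg Z0 hmin.
set et := eta_c N0 N1 lam1 lam2 theta in hLg hmL.
have t0 : 0 < theta.
  by apply: le_lt_trans hX; rewrite mulr_ge0 ?invr_ge0 ?frob2_ge0.
have [et0 het2 het1] := eta_props N0 N1 lam1 lam2 theta hN0 hN1 l1 l2 t0.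
have [al0 hXal] := alpha_props N N0 N1 X lam1 lam2 theta hN l1 l2 hX.
rewrite -/et in et0 het2 het1; rewrite -/al in al0 hXal.
set a := Num.max al (2 * et) in hLg.
have ala : al <= a by rewrite le_max lexx.
have a0 : 0 < a by exact: lt_le_trans ala.
have hXa j n : `|X j n| <= a / 2.
  by apply: le_trans (hXal j n) _; rewrite ler_pM2r ?invr_gt0.
have hreq := gradient_lipschitz_lower X beta a LgH hN hN0 hN1 (ltW b0) a0 hXa hLg.
have /andP[m0 m1] := hm0.
have Lpos : 0 < Lk 0%N by exact: lt_le_trans hL0.
(* Since mu^(0) < 1, the bound on mu^(0) L^(0) is a bound on L^(0) itself. *)
have hLgL : LgH <= Lk 0%N.
  move: hmL; rewrite ge_max => /andP[_ h].
  have : mu 0%N * Lk 0%N <= Lk 0%N by rewrite ger_pMl // ltW.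
  by lra.
have Zk k : Zset X al (z k) by case: k => [//|k]; have [] := hmin k.
have hmu k : [/\ 0 < mu k, 0 < Lk k & Lk 0%N <= Lk k].
  elim: k => [//|k [h1 h2 h3]]; have /andP[t1 _] := ht1.
  have := hstep k; case: ifP => _ [-> ->] //.
  split; [exact: mulr_gt0|by apply: mulr_gt0 => //; lra|].
  by apply: (le_trans h3); rewrite ler_peMl // ltW.
have inv k : lyap (z k) <= lyap_max (N0 := N0) (N1 := N1) al et.
  elim: k => [|k IH].
    apply: (lyap_of_sublevel X lam1 lam2 theta al et _ l1 l2 t0 (ltW al0) et0 het2 het1 (Zk 0%N)).
    (* O(z^0) < theta bounds lam1 e^T V + lam2 |W|^2 by theta, so the sublevel quantity is at most 2
       theta. *)
    have := Robj_le_Oobj X lam1 lam2 beta (z 0%N) (ltW b0) Z0.1.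
    rewrite RobjE -/(tV _) -/(sW _).
    have : 0 <= lam1 * tV (z 0%N).
      apply: mulr_ge0; first exact: ltW.
      by apply: tV_ge0; exact: Omega2_zV_ge0 Z0.1.
    by lra.
  have [h1 h2 h3] := hmu k; have [_ hk] := hmin k.
  apply: (lyap_invariant X lam1 lam2 beta theta al et (Lk k) (mu k) (z k) _ hN l1 l2 (ltW b0)
    t0 (ltW al0) et0 het2 het1 hX h1 h2 _ (Zk _) hk IH).
  by apply: le_trans h3; exact: le_trans hLgL.
have bounded k : rsqn (z k) <= lyap_max (N0 := N0) (N1 := N1) al et.
  by apply: le_trans (inv k); rewrite rsqn_sums /lyap; have := sb2_ge0 (z k); lra.
have [Cg Cg0 HCg] := @Otil_sub_Oobj R N N0 N1 X lam1 lam2 beta.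
have [Ci Ci0 HCi] := @spg_increment R N N0 N1 X lam1 lam2 beta (lyap_max (N0 := N0) (N1 := N1) al et).
have [h1 h2 h3 h4] : [/\ mu n @[n --> \oo] --> 0,
    cvgn (fun k => Oobj X lam1 lam2 beta (z k)),
    cvgn (fun k => Otil X lam1 lam2 beta (z k) (mu k)) &
    limn (fun k => Otil X lam1 lam2 beta (z k) (mu k)) =
    limn (fun k => Oobj X lam1 lam2 beta (z k))].
  apply: (smoothing_schedule (fun k => Otil X lam1 lam2 beta (z k)) _ mu Lk tau1 tau2 tau3 Cg Ci)
    => //.
  - by move=> k m mp; apply: Otil_ge0 => //; [exact: ltW|exact: ltW|exact: ltW|exact: (Zk k).1].
  - by move=> k m mp; exact: HCg.
  - move=> k mk Lp _; apply: HCi => //.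
    by have [_ H] := hmin k; exact: H (Zk k).
by [].
Qed.
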